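(* Let $C_{-1}(x_0,\underline{x})=\frac{1}{\sigma_{m+1}}\frac{x_0-\overline{e_0}\,\underline{x}}{|x|^{m+1}}$ and $C_{-k-1}=\overline{D}^{\,k}C_{-1}$ for $k=1,2,\dots$; these functions are monogenic in $\mathbb{R}^{m+1}\setminus\{O\}$. Let $C_{-k-1}^{\pm}$ denote the restrictions of $C_{-k-1}$ to $\mathbb{R}^{m+1}_\pm$ and let $c_{-k-1}^{\pm}=\lim_{x_0\to0\pm}C_{-k-1}(x_0,\cdot)$ be the distributional limits on $\mathbb{R}^m$. Then for $\ell=1,2,\dots$ $$c_{-2\ell}^+-c_{-2\ell}^-=-\overline{e_0}\,\underline{\partial}^{2\ell-1}\delta,\qquad c_{-2\ell}^++c_{-2\ell}^-=-\underline{\partial}^{2\ell-1}H,$$ leading to the representations by couples of monogenic functions $$\underline{\partial}^{2\ell-1}\delta\longleftrightarrow\bigl(\overline{e_0}\,C_{-2\ell}^+,\ \overline{e_0}\,C_{-2\ell}^-\bigr),\qquad \underline{\partial}^{2\ell-1}H\longleftrightarrow\bigl(-C_{-2\ell}^+,\ C_{-2\ell}^-\bigr),$$ and $$c_{-2\ell-1}^+-c_{-2\ell-1}^-=\underline{\partial}^{2\ell}\delta,\qquad c_{-2\ell-1}^++c_{-2\ell-1}^-=\overline{e_0}\,\underline{\partial}^{2\ell}H,$$ leading to the representations by couples of monogenic functions $$\underline{\partial}^{2\ell}\delta\longleftrightarrow\bigl(C_{-2\ell-1}^+,\ C_{-2\ell-1}^-\bigr),\qquad \underline{\partial}^{2\ell}H\longleftrightarrow\bigl(e_0\,C_{-2\ell-1}^+,\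 \overline{e_0}\,C_{-2\ell-1}^-\bigr).$$
   Context: $\mathbb{R}_{0,m+1}$ is the real Clifford algebra generated by $e_0,e_1,\dots,e_m$ with $e_\alpha e_\beta+e_\beta e_\alpha=-2\delta_{\alpha\beta}$; $\overline{e_0}=-e_0$. Points of $\mathbb{R}^{m+1}$ are written $x=x_0e_0+\underline{x}$ with $\underline{x}=\sum_{j=1}^m x_je_j$; $r=|\underline{x}|$, $\underline{\omega}=\underline{x}/r$, $|x|^2=x_0^2+r^2$. $\mathbb{R}^{m+1}_\pm=\{\pm x_0>0\}$, and the boundary $\{x_0=0\}$ is identified with $\mathbb{R}^m$. $\sigma_{n}=\frac{2\pi^{n/2}}{\Gamma(n/2)}$ is the area of the unit sphere in $\mathbb{R}^{n}$. Put $\underline{\partial}=\sum_{j=1}^m e_j\partial_{x_j}$, $D=\frac12(\partial_{x_0}+\overline{e_0}\,\underline{\partial})$, $\overline{D}=\frac12(\partial_{x_0}-\overline{e_0}\,\underline{\partial})$. A continuously differentiable $\mathbb{R}_{0,m+1}$-valued function $F$ on an open set is called (left-)monogenic there if $DF=0$. $\delta$ is the Dirac distribution on $\mathbb{R}^m$ and $H=-\frac{2}{\sigma_{m+1}}\,\mathrm{Pv}\,\frac{\underline{\omega}}{r^m}$ is the (Clifford-vector valued) Hilbert kernel, $\mathrm{Pv}$ being the Cauchy principal value. For $n\in\mathbb{N}$, $\underline{\partial}^n\delta$ and $\underline{\partial}^nH=\underline{\partial}^n\delta\ast H$ denote the $n$-fold application of $\underline{\partial}$, from the left and in the sense of distributions.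 Notation: for a distribution $T$ on $\mathbb{R}^m$, $T\longleftrightarrow(F,G)$ means that $T(\underline{x})=\lim_{x_0\to0+}F(x_0,\underline{x})-\lim_{x_0\to0-}G(x_0,\underline{x})$, the limits being taken in distributional sense and the functions $F$ and $G$ being monogenic in the respective half-spaces $\mathbb{R}^{m+1}_+$ and $\mathbb{R}^{m+1}_-$.
   Formalization: In the couples for ∂^{2ℓ-1}δ and ∂^{2ℓ}H, whose functions carry a left factor e_0 or its conjugate, ''monogenic'' is taken as right monogenic (FD=0), since left multiplication by e_0 turns D into its conjugate and these functions are not left monogenic. *)

(* Defs.v *)
From HB Require Import structures.
From mathcomp Require Import all_boot all_order all_algebra.
From mathcomp Require Import all_classical all_reals all_analysis.
Set Implicit Arguments.
Unset Strict Implicit.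
Unset Printing Implicit Defensive.
Import Order.TTheory GRing.Theory Num.Theory.
Import numFieldNormedType.Exports.
Local Open Scope ring_scope.


(* The real Clifford algebra R_{0,n}, as the vector space with basis the blades
   e_A = e_{i_1} ... e_{i_k}, for A = {i_1 < ... < i_k} a set of indices. *)
Definition clifford (R : realType) (n : nat) := {ffun {set 'I_n} -> R}.

Section CliffordRing.
Variables (R : realType) (n : nat).
Implicit Types (A B C D : {set 'I_n}) (a b c : clifford R n) (k : R).

HB.instance Definition _ := GRing.Lmodule.on (clifford R n).

Definition symdiff A B : {set 'I_n} := [set i | (i \in A) (+) (i \in B)].

(* e_A e_B = blade_sign A B e_{A symdiff B}: each pair (i, j) of A x B with
   j < i costs a transposition, and each common index costs e_i^2 = -1. *)
Definition blade_sign A B : R := \prod_(i in A) \prod_(j in B | (j <= i)%N) (-1).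

Definition cl_coord a A : R := a A.

Definition blade A : clifford R n := [ffun B => (B == A)%:R].

Definition cl_mul a b : clifford R n :=
  [ffun C => \sum_A blade_sign A (symdiff A C) * cl_coord a A
                    * cl_coord b (symdiff A C)].

Lemma symdiffA A B C : symdiff A (symdiff B C) = symdiff (symdiff A B) C.
Proof. by apply/setP => i; rewrite !inE addbA. Qed.
Lemma symdiffC A B : symdiff A B = symdiff B A.
Proof. by apply/setP => i; rewrite !inE addbC. Qed.
Lemma symdiffK A B : symdiff A (symdiff A B) = B.
Proof. by apply/setP => i; rewrite !inE addKb. Qed.
Lemma symdiff0 A : symdiff A finset.set0 = A.
Proof. by apply/setP => i; rewrite !inE addbF. Qed.
Lemma sym0diff A : symdiff finset.set0 A = A.
Proof. by apply/setP => i; rewrite !inE. Qed.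
Lemma symdiffv A : symdiff A A = finset.set0.
Proof. by apply/setP => i; rewrite !inE addbb. Qed.

Lemma prod_symdiff (g : 'I_n -> R) A B : (forall i, g i * g i = 1) ->
  \prod_(i in symdiff A B) g i = \prod_(i in A) g i * \prod_(i in B) g i.
Proof.
move=> g2; rewrite [LHS]big_mkcond [X in _ = X * _]big_mkcond [X in _ = _ * X]big_mkcond.
rewrite -big_split /=; apply: eq_bigr => i _; rewrite inE.
by do 2 case: (i \in _) => //=; rewrite ?g2 ?mulr1 ?mul1r.
Qed.

Lemma blade_signDl A B C :
  blade_sign (symdiff A B) C = blade_sign A C * blade_sign B C.
Proof.
rewrite /blade_sign prod_symdiff // => i.
by rewrite -big_split /= big1 // => j _; rewrite mulrNN mulr1.
Qed.

Lemma blade_signDr A B C :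
  blade_sign A (symdiff B C) = blade_sign A B * blade_sign A C.
Proof.
rewrite /blade_sign -big_split /=; apply: eq_bigr => i _.
rewrite !big_mkcondr /= prod_symdiff // => j.
by case: ifP => _; rewrite ?mulrNN mulr1.
Qed.

Lemma blade_sign_sq A B : blade_sign A B * blade_sign A B = 1.
Proof.
rewrite /blade_sign -big_split big1 //= => i _.
by rewrite -big_split big1 //= => j _; rewrite mulrNN mulr1.
Qed.

Lemma blade_sign0l A : blade_sign finset.set0 A = 1.
Proof. by rewrite /blade_sign big_set0. Qed.
Lemma blade_sign0r A : blade_sign A finset.set0 = 1.
Proof.
rewrite /blade_sign big1 // => i _; rewrite big1 // => j.
by rewrite inE.
Qed.

Lemma cl_mulA : associative cl_mul.
Proof.
move=> a b c; apply/ffunP => E; rewrite !ffunE /cl_coord.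
under eq_bigr => A _.
  rewrite ffunE (reindex_inj (can_inj (symdiffK A))) /= mulr_sumr.
  over.
under [RHS]eq_bigr => F _ do rewrite ffunE mulr_sumr mulr_suml.
rewrite exchange_big /=; apply: eq_bigr => F _; apply: eq_bigr => A _.
rewrite /cl_coord symdiffA (symdiffC (symdiff A F) A) symdiffK.
have sE : blade_sign A (symdiff A E) * blade_sign (symdiff A F) (symdiff F E) =
          blade_sign F (symdiff F E) * blade_sign A (symdiff A F).
  rewrite blade_signDl mulrA mulrC; congr (_ * _).
  rewrite -blade_signDr; congr blade_sign.
  by apply/setP => i; rewrite !inE; do 3 case: (i \in _).
by rewrite mulrACA !mulrA sE -!mulrA; congr (_ * (_ * _)); rewrite mulrCA.
Qed.

Lemma cl_mul1l : left_id (blade finset.set0) cl_mul.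
Proof.
move=> a; apply/ffunP => C; rewrite ffunE (bigD1 finset.set0) //= big1 => [|A A0].
  by rewrite /cl_coord ffunE eqxx sym0diff blade_sign0l !mul1r addr0.
by rewrite /cl_coord ffunE (negbTE A0) mulr0 mul0r.
Qed.

Lemma cl_mul1r : right_id (blade finset.set0) cl_mul.
Proof.
move=> a; apply/ffunP => C; rewrite ffunE (bigD1 C) //= big1 => [|A AC].
  by rewrite /cl_coord ffunE symdiffv eqxx blade_sign0r mul1r mulr1 addr0.
rewrite /cl_coord ffunE; case: eqP => [AC0|]; last by rewrite mulr0.
by rewrite -(symdiffK A C) AC0 symdiff0 eqxx in AC.
Qed.

Lemma cl_mulDl : left_distributive cl_mul +%R.
Proof.
move=> a b c; apply/ffunP => C; rewrite !ffunE -big_split /=.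
by apply: eq_bigr => A _; rewrite /cl_coord ffunE mulrDr mulrDl.
Qed.

Lemma cl_mulDr : right_distributive cl_mul +%R.
Proof.
move=> a b c; apply/ffunP => C; rewrite !ffunE -big_split /=.
by apply: eq_bigr => A _; rewrite /cl_coord ffunE mulrDr.
Qed.

Lemma cl_oner_neq0 : blade finset.set0 != 0.
Proof.
apply/eqP => /ffunP/(_ finset.set0); rewrite !ffunE eqxx.
by move/eqP; rewrite oner_eq0.
Qed.

HB.instance Definition _ := GRing.Zmodule_isNzRing.Build (clifford R n)
  cl_mulA cl_mul1l cl_mul1r cl_mulDl cl_mulDr cl_oner_neq0.

Lemma cl_scaleAl k a b : k *: (a * b) = k *: a * b.
Proof.
apply/ffunP => C; rewrite !ffunE /GRing.scale /= mulr_sumr.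
by apply: eq_bigr => A _; rewrite /cl_coord ffunE !mulrA (mulrC k).
Qed.

HB.instance Definition _ :=
  GRing.Lmodule_isLalgebra.Build R (clifford R n) cl_scaleAl.

Lemma cl_scaleAr k a b : k *: (a * b) = a * (k *: b).
Proof.
apply/ffunP => C; rewrite !ffunE /GRing.scale /= mulr_sumr.
by apply: eq_bigr => A _; rewrite /cl_coord ffunE mulrCA.
Qed.

HB.instance Definition _ :=
  GRing.Lalgebra_isAlgebra.Build R (clifford R n) cl_scaleAr.

Lemma blade_mul A B : blade A * blade B = blade_sign A B *: blade (symdiff A B).
Proof.
apply/ffunP => C; rewrite !ffunE (bigD1 A) //= big1 => [|D DA].
  rewrite /cl_coord !ffunE eqxx mulr1 addr0.
  have -> : (symdiff A C == B) = (C == symdiff A B).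
    by apply/eqP/eqP => [<-|->]; rewrite symdiffK.
  by case: eqP => [->|_]; rewrite ?symdiffK ?mulr0 // scaler0.
by rewrite /cl_coord ffunE (negbTE DA) mulr0 mul0r.
Qed.

Definition gen (i : 'I_n) : clifford R n := blade [set i].

Lemma gen_anticomm i j :
  gen i * gen j + gen j * gen i = (- 2 * (i == j)%:R) *: 1.
Proof.
rewrite !blade_mul (symdiffC [set j]) -scalerDl /blade_sign.
rewrite !big_set1 ![\prod_(_ in [set _] | _) _]big_mkcondr /= !big_set1.
have [->|ij] := eqVneq i j; first by rewrite leqnn symdiffv mulr1 -opprD.
rewrite mulr0 scale0r; case: (ltngtP (j : nat) i) => [_|_|/val_inj ji].
- by rewrite addNr scale0r.
- by rewrite addrN scale0r.
- by rewrite ji eqxx in ij.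
Qed.

End CliffordRing.

Local Open Scope classical_set_scope.

Section LebesgueMeasureRn.
Variable R : realType.
Local Notation RT := (measurableTypeR R).

Definition tcons n (p : RT * n.-tuple RT) : n.+1.-tuple RT :=
  [tuple of p.1 :: p.2].
Definition tuncons n (t : n.+1.-tuple RT) : RT * n.-tuple RT :=
  (thead t, [tuple of behead t]).

Lemma measurable_tcons n : measurable_fun [set: RT * n.-tuple RT] (@tcons n).
Proof. exact: measurable_cons. Qed.

Lemma measurable_tuncons n : measurable_fun [set: n.+1.-tuple RT] (@tuncons n).
Proof.
apply: measurable_fun_pair; first exact: measurable_tnth.
exact: measurable_behead.
Qed.

Section step.
Variables (n : nat) (mu : {sigma_finite_measure set (n.-tuple RT) -> \bar R}).
Definition lebesgue_cons : set (n.+1.-tuple RT) -> \bar R :=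
  pushforward (@lebesgue_measure R \x mu)%E (@tcons n).


Let lebesgue_cons0 : lebesgue_cons set0 = 0%E.
Proof. by apply: measure0; exact: measurable_tcons. Qed.

Let lebesgue_cons_ge0 A : (0 <= lebesgue_cons A)%E.
Proof. by apply: measure_ge0; exact: measurable_tcons. Qed.

Let lebesgue_cons_sigma_additive : semi_sigma_additive lebesgue_cons.
Proof. by apply: measure_semi_sigma_additive; exact: measurable_tcons. Qed.

HB.instance Definition _ := isMeasure.Build _ _ _ lebesgue_cons
  lebesgue_cons0 lebesgue_cons_ge0 lebesgue_cons_sigma_additive.

Let lebesgue_cons_sigma_finite : sigma_finite setT lebesgue_cons.
Proof.
have /sigma_finiteP[F [TF ndF Foo]] := sigma_finiteT (@lebesgue_measure R).
have /sigma_finiteP[G [TG ndG Goo]] := sigma_finiteT mu.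
exists (fun k => @tuncons n @^-1` (F k `*` G k)).
  rewrite -preimage_bigcup (_ : \bigcup_k (F k `*` G k) = setT) ?preimage_setT //.
  rewrite -subTset => -[x y] _.
  have [k _ Fkx] : (\bigcup_k F k) x by rewrite -TF.
  have [l _ Gly] : (\bigcup_k G k) y by rewrite -TG.
  exists (maxn k l) => //; split.
  - by move: x Fkx; exact/subsetPset/ndF/leq_maxl.
  - by move: y Gly; exact/subsetPset/ndG/leq_maxr.
move=> k; have [mF Fk] := Foo k; have [mG Gk] := Goo k; split.
  rewrite -[X in measurable X]setTI; apply: measurable_tuncons => //.
  exact: measurableX.
rewrite /lebesgue_cons /pushforward -comp_preimage.
rewrite (_ : @tuncons n \o @tcons n = id); last first.
  by apply/funext => -[x t]; congr pair; apply/val_inj.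
by rewrite preimage_id product_measure1E// lte_mul_pinfty// ge0_fin_numE.
Qed.

HB.instance Definition _ := Measure_isSigmaFinite.Build _ _ _ lebesgue_cons
  lebesgue_cons_sigma_finite.
End step.

(* Lebesgue measure on R^n, carried by n-tuples: the n-fold product of the
   one-dimensional Lebesgue measure. *)
Fixpoint lebesgue_rV n : {sigma_finite_measure set (n.-tuple RT) -> \bar R} :=
  if n is k.+1 then lebesgue_cons (lebesgue_rV k) else \d_ [tuple].

Definition integral_rV n (f : 'rV[R]_n -> R) : R :=
  \int[lebesgue_rV n]_t f (\row_i tnth t i).
End LebesgueMeasureRn.

Section Calculus.
Variables (R : realType) (n : nat).
Implicit Types (f phi : 'rV[R]_n -> R).

Definition partial (i : 'I_n) f : 'rV[R]_n -> R := 'D_(delta_mx 0 i) f.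

Definition partials (s : seq 'I_n) f : 'rV[R]_n -> R := foldr partial f s.

Definition enorm (x : 'rV[R]_n) : R := Num.sqrt (\sum_i x 0 i ^+ 2).

Definition smooth f := forall s x, differentiable (partials s f) x.

Definition supported_in (K : set 'rV[R]_n) f := closure [set x | f x != 0] `<=` K.

Definition test_function phi :=
  smooth phi /\ exists2 K, compact K & supported_in K phi.

End Calculus.

Definition Gamma (R : realType) (s : R) : R :=
  \int[lebesgue_measure]_(t in `]0, +oo[) (t `^ (s - 1) * expR (- t)).

Definition sphere_area (R : realType) (n : nat) : R :=
  2 * pi `^ (n%:R / 2) / Gamma (n%:R / 2).

Section CliffordAnalysis.
Variables (R : realType) (m : nat).

Local Notation Cl := (clifford R m.+1).

Definition e0 : Cl := gen R ord0.
Definition e0bar : Cl := - e0.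
Definition e_ (j : 'I_m) : Cl := gen R (lift ord0 j).

Definition vec (y : 'rV[R]_m) : Cl := \sum_j y 0 j *: e_ j.

(* A point x = x0 e0 + y of R^(m+1) is the row vector (x0, y). *)
Definition point (x0 : R) (y : 'rV[R]_m) : 'rV[R]_m.+1 := row_mx x0%:M y.
Definition normal_part (x : 'rV[R]_m.+1) : R := x 0 ord0.
Definition tangent_part (x : 'rV[R]_m.+1) : 'rV[R]_m := \row_j x 0 (lift ord0 j).

Definition upper_half : set 'rV[R]_m.+1 := [set x | 0 < normal_part x].
Definition lower_half : set 'rV[R]_m.+1 := [set x | normal_part x < 0].
Definition punctured : set 'rV[R]_m.+1 := [set x | x != 0].

Implicit Types (F G : 'rV[R]_m.+1 -> Cl).

Definition clpartial (i : 'I_m.+1) F (x : 'rV[R]_m.+1) : Cl :=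
  [ffun A => partial i (fun z => cl_coord (F z) A) x].

Definition diracx F (x : 'rV[R]_m.+1) : Cl :=
  \sum_j e_ j * clpartial (lift ord0 j) F x.

Definition Dop F (x : 'rV[R]_m.+1) : Cl :=
  2^-1 *: (clpartial ord0 F x + e0bar * diracx F x).

Definition Dbar F (x : 'rV[R]_m.+1) : Cl :=
  2^-1 *: (clpartial ord0 F x - e0bar * diracx F x).

(* The operator D acting from the right, F |-> F D. *)
Definition Dop_right F (x : 'rV[R]_m.+1) : Cl :=
  2^-1 *: (clpartial ord0 F x +
           \sum_j clpartial (lift ord0 j) F x * (e0bar * e_ j)).

Definition C1_on (U : set 'rV[R]_m.+1) F :=
  forall A x, U x -> differentiable (fun z => cl_coord (F z) A) x /\
    forall i, {for x, continuous (partial i (fun z => cl_coord (F z) A))}.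

(* These are used for open U only. *)
Definition left_monogenic (U : set 'rV[R]_m.+1) F :=
  C1_on U F /\ forall x, U x -> Dop F x = 0.

Definition right_monogenic (U : set 'rV[R]_m.+1) F :=
  C1_on U F /\ forall x, U x -> Dop_right F x = 0.

Definition cauchy_kernel (x : 'rV[R]_m.+1) : Cl :=
  (sphere_area R m.+1)^-1 *: ((enorm x ^+ m.+1)^-1 *:
    (normal_part x *: 1 - e0bar * vec (tangent_part x))).

(* Cneg n is the potential C_{-n}, for n >= 1. *)
Definition Cneg (n : nat) : 'rV[R]_m.+1 -> Cl := iter n.-1 Dbar cauchy_kernel.

(* Clifford-valued distributions on R^m are functionals on real-valued
   functions; only their values at test functions are meaningful. *)
Definition functional := ('rV[R]_m -> R) -> Cl.
Implicit Types (T S : functional).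

Definition is_distribution T :=
  (forall (a : R) phi psi, test_function phi -> test_function psi ->
     T (fun y => a * phi y + psi y) = a *: T phi + T psi) /\
  (forall K : set 'rV[R]_m, compact K ->
     exists (c : R) (N : nat), forall phi (B : R),
       test_function phi -> supported_in K phi ->
       (forall s y, (size s <= N)%N -> `|partials s phi y| <= B) ->
       forall A, `|cl_coord (T phi) A| <= c * B).

Definition eq_dist T S := forall phi, test_function phi -> T phi = S phi.

Definition addd T S : functional := fun phi => T phi + S phi.
Definition oppd T : functional := fun phi => - T phi.
Definition lmuld (a : Cl) T : functional := fun phi => a * T phi.

(* The Dirac operator \sum_j e_j d/dx_j in the sense of distributions. *)
Definition diracd T : functional :=
  fun phi => - \sum_j e_ j * T (partial j phi).

Definition delta : functional := fun phi => phi 0 *: 1.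

Definition regular (f : 'rV[R]_m -> Cl) : functional :=
  fun phi => [ffun A => integral_rV (fun y => cl_coord (f y) A * phi y)].

Definition pv (f : 'rV[R]_m -> Cl) : functional :=
  fun phi => [ffun A => lim ((fun eps : R =>
    cl_coord (regular (fun y => if eps < enorm y then f y else 0) phi) A)
      @ 0^'+)].

Definition hilbert : functional := fun phi =>
  (- (2 / sphere_area R m.+1)) *:
    pv (fun y => (enorm y ^+ m)^-1 *: ((enorm y)^-1 *: vec y)) phi.

Definition lim_above F T :=
  is_distribution T /\
  forall phi A, test_function phi ->
    (fun x0 : R => cl_coord (regular (fun y => F (point x0 y)) phi) A) @ 0^'+
      --> cl_coord (T phi) A.

Definition lim_below F T :=
  is_distribution T /\
  forall phi A, test_function phi ->
    (fun x0 : R => cl_coord (regular (fun y => F (point x0 y)) phi) A) @ 0^'-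
      --> cl_coord (T phi) A.

(* T <--> (F, G). The values of F outside the open upper half space, and those
   of G outside the open lower one, are irrelevant. The side of the monogenicity
   is a parameter: D (e0 F) = e0 (Dbar F), so a left monogenic F does not give a
   left monogenic e0 F, whereas (e0 F) D = e0 (F D), so right monogenicity is
   preserved by left multiplication by e0. *)
Definition represents (monogenic : set 'rV[R]_m.+1 -> ('rV[R]_m.+1 -> Cl) -> Prop)
    T F G :=
  [/\ monogenic upper_half F, monogenic lower_half G &
      exists TF TG, [/\ lim_above F TF, lim_below G TG &
                        eq_dist T (addd TF (oppd TG))]].

End CliffordAnalysis.

(* Main.v *)
(* Off the origin every C_{-k-1} has components obtained by applying d/dx_0 k times to
   x_i / |x|^(m+1); these fields are divergence free and curl free, which is exactly monogenicity
   (from both sides), and D C = 0 turns Dbar into the tangential operator - e0bar dirac. Integrating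
   by parts in the slice variable moves it onto the test function, so the boundary values of all
   potentials follow from those of C_{-1}, namely  +- delta / 2 + e0bar H / 2,  and the identities
   become algebra with (- e0bar dirac)^2 = dirac^2.
   The scalar part of C_{-1} is the Poisson kernel, an approximate identity of mass sigma_(m+1) / 2
   (computed by Tonelli from the Gamma integral). Its vector part is odd: against the odd part of the
   test function it is dominated by |y|^(1-m) on a ball, so it converges, as do the truncations in the
   definition of Pv, by dominated convergence. Local integrability of |y|^(1-m) comes from integrating
   the Poisson kernel over the normal variable. *)
From HB Require Import structures.
From Pilot Require Import Defs.
From mathcomp Require Import all_boot all_order all_algebra.
From mathcomp Require Import all_classical all_reals all_analysis.
From mathcomp Require Import measurable_realfun ring lra.
Import Order.TTheory GRing.Theory Num.Theory.
Import numFieldNormedType.Exports.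
Set Implicit Arguments.
Unset Strict Implicit.
Unset Printing Implicit Defensive.
Local Open Scope classical_set_scope.
Local Open Scope ring_scope.

(** * Measurability on R^n *)

(** [sphere_area] is defined through [Gamma], so the Poisson mass must come out as pi^((m+1)/2) /
    Gamma((m+1)/2); Gaussian integrals and Tonelli give exactly this, with no surface measure or
    polar coordinates. The measure lives on tuples with the product sigma-algebra, while limits and
    derivatives are taken for row vectors with the sup norm, so continuity must first be turned into
    measurability. The truncations in Pv and the slices of the vector part of the Cauchy kernel are
    two even regularisations of one singular kernel. A single convergence statement covers both,
    which is why the vector part of the boundary value is exactly [hilbert]. Both half-spaces are
    handled at once by a sign s with s^2 = 1: passing from height t to s t preserves |x| and changes
    only the scalar part, so the difference of the limits sees only delta and their sum only H. The
    split by parity arises because e0bar anticommutes with the tangential Dirac operator, hence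
    commutes with its square. *)

Lemma bigcup_countType_measurable d (T : measurableType d) (I : countType)
    (F : I -> set T) :
  (forall i, measurable (F i)) -> measurable (\bigcup_i F i).
Proof.
move=> mF.
rewrite (_ : \bigcup_i F i = \bigcup_k oapp F set0 (unpickle k)); last first.
  apply/seteqP; split=> [x [i _ Fx]|x [k _]].
    by exists (pickle i) => //; rewrite pickleK.
  by case: (unpickle k) => //= i Fx; exists i.
by apply: bigcupT_measurable => k; case: (unpickle k) => //= i.
Qed.

Section MeasurableRow.
Context {R : realType} {n : nat}.
Local Notation RT := (measurableTypeR R).

Definition row_of (t : n.-tuple RT) : 'rV[R]_n := \row_i tnth t i.

Definition measurable_rV (f : 'rV[R]_n -> R) :=
  measurable_fun [set: n.-tuple RT] (f \o row_of).

Definition integrable_rV (f : 'rV[R]_n -> R) :=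
  (lebesgue_rV R n).-integrable setT (EFin \o (f \o row_of)).

Definition eintegral_rV (f : 'rV[R]_n -> \bar R) : \bar R :=
  (\int[lebesgue_rV R n]_t f (row_of t))%E.

(** Balls of row vectors are those of the sup norm, hence finite intersections of coordinate
    slabs. *)
Lemma measurable_box (y : 'rV[R]_n) (r : R) : 0 < r ->
  measurable [set t : n.-tuple RT | ball y r (row_of t)].
Proof.
move=> r0; rewrite (_ : [set _ | _] =
    \bigcap_(i in [set: 'I_n]) ((fun t : n.-tuple RT => tnth t i) @^-1` ball (y 0 i) r));
  last first.
  apply/seteqP; split=> [t /= [H1 H2] i _ /=|t H /=].
    by have := H2 0 i; rewrite !mxE.
  by split=> // i j; rewrite !mxE ord1; exact: (H j).
apply: fin_bigcap_measurable => // i _.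
rewrite -[X in measurable X]setTI; apply: measurable_tnth => //.
by apply: open_measurable; exact: ball_open.
Qed.

(** Boxes with rational centre and radius 1/(k+1) form a countable family, and those contained in
    [U] already cover it. *)
Lemma open_measurable_rV (U : set 'rV[R]_n) : open U ->
  measurable (row_of @^-1` U).
Proof.
move=> oU.
pose C (p : {ffun 'I_n -> rat} * nat) : 'rV[R]_n := \row_i ratr (p.1 i).
pose r (p : {ffun 'I_n -> rat} * nat) : R := p.2.+1%:R^-1.
have r0 p : 0 < r p by rewrite invr_gt0.
rewrite (_ : row_of @^-1` U = \bigcup_p
    if pselect (ball (C p) (r p) `<=` U) then [set t | ball (C p) (r p) (row_of t)]
    else set0); last first.
  apply/seteqP; split => [t /= Ut|t [p _]]; last by case: pselect => // + /= ?; apply.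
  have /nbhs_ballP[e /= e0 eU] := open_nbhs_nbhs (conj oU Ut).
  have [k ke] : exists k : nat, (k.+1%:R^-1 : R) < e / 2.
    have [N _ HN] := near_infty_natSinv_lt (PosNum (divr_gt0 e0 (ltr0Sn R 1))).
    by exists N; apply: HN => /=.
  have /choice[q Hq] : forall i, exists q : rat, ball (tnth t i) (k.+1%:R^-1) (ratr q : R).
    move=> i; have kt : tnth t i - k.+1%:R^-1 < tnth t i + k.+1%:R^-1.
      by rewrite ltrBlDr -addrA ltrDl addr_gt0// invr_gt0.
    have [q] := rat_in_itvoo kt.
    by rewrite in_itv /= => Hq; exists q; rewrite ball_itv/= in_itv.
  exists ([ffun i => q i], k) => //.
  have row_q : ball (C ([ffun i => q i], k)) (r ([ffun i => q i], k)) (row_of t).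
    split; [exact: r0|move=> i j].
    by rewrite !mxE ffunE; apply: ball_sym; exact: Hq.
  case: pselect => // -[] z bz; apply: eU.
  (* Two points of one small box are within twice its radius, which is why k was chosen with 1/(k+1)
     < e/2. *)
  apply: (@le_ball _ _ _ (k.+1%:R^-1 + k.+1%:R^-1)).
    by rewrite [leRHS]splitr lerD // ltW.
  by apply: ball_triangle bz; apply: ball_sym.
apply: bigcup_countType_measurable => p.
case: (pselect (ball (C p) (r p) `<=` U)) => ? /=; last exact: measurable0.
exact: measurable_box.
Qed.

Lemma continuous_measurable_rV (f : 'rV[R]_n -> R) :
  continuous f -> measurable_rV f.
Proof.
move=> /continuousP cf; apply: (measurability _ (RGenOpens.measurableE R)).
move=> _ [_ [a [b ->] <-]]; rewrite setTI comp_preimage.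
apply: open_measurable_rV; apply: cf; exact: interval_open.
Qed.

End MeasurableRow.

(** * Affine changes of variables *)

Section Affine.
Context {R : realType}.
Local Notation RT := (measurableTypeR R).
Local Notation mu := (@lebesgue_measure R).

Lemma ge0_integral_lebesgue_cons n (f : n.+1.-tuple RT -> \bar R) :
  measurable_fun setT f -> (forall t, 0 <= f t)%E ->
  (\int[lebesgue_rV R n.+1]_t f t =
   \int[mu]_x \int[lebesgue_rV R n]_s f (tcons (x, s)))%E.
Proof.
move=> mf f0; rewrite /= /lebesgue_cons.
rewrite ge0_integral_pushforward//=; last exact: measurable_tcons.
rewrite preimage_setT fubini_tonelli1//=.
by apply: measurableT_comp => //; exact: measurable_tcons.
Qed.

Lemma ge0_integral_affine1 (a b : R) (f : RT -> \bar R) : a != 0 ->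
  measurable_fun setT f -> (forall x, 0 <= f x)%E ->
  (\int[mu]_x f (a * x + b)%R = (`|a|^-1)%:E * \int[mu]_x f x)%E.
Proof.
move=> a0 mf f0.
pose h (x : RT) : RT := a * x + b.
have mh : measurable_fun setT h.
  by apply: measurable_funD => //; exact: mulrl_measurable.
have na : 0 <= `|a|%R by [].
pose nu := mscale (NngNum na)
  (measure_function_pushforward__canonical__measure_function_Measure mu mh).
(* Uniqueness of Lebesgue measure: pushing |a| mu forward along [h] gives every interval ]c, d] its
   length. *)
have -> : (\int[mu]_x f x = \int[nu]_x f x)%E.
  apply: eq_measure_integral => //= A mA _.
  apply: lebesgue_measure_unique => //= _ [[c d]] _ <-.
  rewrite /nu /mscale /= /pushforward.
  rewrite lebesgue_measure_itv /=.
  have [a_gt0|a_lt0|/esym/eqP] := ltgtP 0 a; last by rewrite (negPf a0).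
    have -> : h @^-1` `]c, d] = `](c - b) / a, (d - b) / a]%classic.
      apply/seteqP; split => x; rewrite /h /= !in_itv /= ltr_pdivrMr// ler_pdivlMr//;
      by rewrite mulrC ltrBlDr lerBrDr.
    rewrite lebesgue_measure_itv /= !lte_fin ltr_pM2r ?invr_gt0// ltrD2r.
    case: ifPn => _; rewrite ?mule0//.
    by rewrite -!EFinB -EFinM gtr0_norm//; congr EFin; field.
  (* A negative slope exchanges the open and the closed end; the length is unaffected. *)
  have -> : h @^-1` `]c, d] = `[(d - b) / a, (c - b) / a[%classic.
    apply/seteqP; split => x; rewrite /h /= !in_itv /= ltr_ndivlMr// ler_ndivrMr//;
    by rewrite andbC mulrC ltrBlDr lerBrDr.
  rewrite lebesgue_measure_itv /= !lte_fin ltr_nM2r ?invr_lt0// ltrD2r.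
  case: ifPn => _; rewrite ?mule0//.
  by rewrite -!EFinB -EFinM ltr0_norm//; congr EFin; field.
rewrite ge0_integral_mscale//= ge0_integral_pushforward//= preimage_setT.
by rewrite muleA -EFinM mulVf ?normr_eq0// mul1e.
Qed.

Lemma measurable_affine n (a : R) (c : n.-tuple R) :
  measurable_fun setT
    (fun t : n.-tuple RT => [tuple a * tnth t i + tnth c i | i < n] : n.-tuple RT).
Proof.
apply/measurable_fun_tnthP => i.
rewrite (_ : _ \o _ = (fun t => a * tnth t i + tnth c i)); last first.
  by apply/funext => t /=; rewrite tnth_mktuple.
apply: measurable_funD => //; apply: measurable_funM => //; exact: measurable_tnth.
Qed.

(** Induction on the dimension: Tonelli splits off the first coordinate, and each coordinate
    contributes one factor 1/|a|. *)
Lemma ge0_integral_affine n (a : R) (b : n.-tuple R) (f : n.-tuple RT -> \bar R) :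
  a != 0 -> measurable_fun setT f -> (forall t, 0 <= f t)%E ->
  (\int[lebesgue_rV R n]_t f [tuple a * tnth t i + tnth b i | i < n]%R =
   (`|a|^-1 ^+ n)%:E * \int[lebesgue_rV R n]_t f t)%E.
Proof.
move=> a0; elim: n b f => [|n IH] b f mf f0.
  rewrite expr0 mul1e; apply: eq_integral => t _; congr f.
  by rewrite tuple0 [RHS]tuple0.
have mfc : measurable_fun setT (f \o @tcons R n).
  by apply: measurableT_comp => //; exact: measurable_tcons.
have ms x : measurable_fun setT (fun s : n.-tuple RT => f (tcons (x, s))).
  exact: (measurable_fun_pair2 x mfc).
have mF : measurable_fun setT (fun x : RT => \int[lebesgue_rV R n]_s f (tcons (x, s)))%E.
  by apply: (measurable_fun_fubini_tonelli_F (m2 := lebesgue_rV R n) (f \o @tcons R n)) => // x; apply: f0.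
rewrite ge0_integral_lebesgue_cons//; last by apply: measurableT_comp => //; exact: measurable_affine.
under eq_integral => x _.
  rewrite (_ : (fun s => _) = fun s : n.-tuple RT => f (tcons ((a * x + thead b)%R,
     [tuple a * tnth s i + tnth [tuple of behead b] i | i < n]%R))); last first.
    apply/funext => s; congr f; apply: eq_from_tnth => i; rewrite tnth_mktuple.
    case: (unliftP ord0 i) => [j|] ->.
      rewrite !tnthS tnth_mktuple tnth_behead; congr (_ + tnth b _).
      by apply/val_inj; rewrite /= inordK//= ltnS.
    by rewrite !tnth0.
  rewrite (IH [tuple of behead b] (fun s => f (tcons ((a * x + thead b)%R, s))))//.
  over.
rewrite ge0_integralZl//=.
- rewrite (@ge0_integral_affine1 a (thead b) (fun x => \int[lebesgue_rV R n]_s f (tcons (x, s)))%E a0)//=.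
  + by rewrite muleA -EFinM -exprSr ge0_integral_lebesgue_cons.
  + by move=> x; apply: integral_ge0.
- by apply: (measurableT_comp mF); apply: measurable_funD => //; exact: mulrl_measurable.
- by move=> x _; apply: integral_ge0.
Qed.


Lemma row_of_affine n (a : R) (b : 'rV[R]_n) (t : n.-tuple RT) :
  a *: row_of t + b =
  row_of ([tuple a * tnth t i + tnth [tuple b 0 i | i < n] i | i < n] : n.-tuple RT).
Proof. by apply/rowP => i; rewrite !mxE !tnth_mktuple. Qed.

Lemma measurable_fun_rV_affine d (T : measurableType d) n (a : R) (b : 'rV[R]_n)
    (f : 'rV[R]_n -> T) : measurable_fun setT (f \o row_of) ->
  measurable_fun setT (fun t : n.-tuple RT => f (a *: row_of t + b)).
Proof.
move=> mf; under eq_fun do rewrite row_of_affine.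
by apply: (measurableT_comp mf); exact: measurable_affine.
Qed.

Lemma eintegral_rV_affine n (a : R) (b : 'rV[R]_n) (f : 'rV[R]_n -> \bar R) :
  a != 0 -> measurable_fun setT (f \o row_of) -> (forall y, 0 <= f y)%E ->
  (eintegral_rV (fun y => f (a *: y + b)%R) = (`|a|^-1 ^+ n)%:E * eintegral_rV f)%E.
Proof.
move=> a0 mf f0; rewrite /eintegral_rV.
under eq_integral do rewrite row_of_affine.
exact: (@ge0_integral_affine n a [tuple b 0 i | i < n] (f \o row_of) a0 mf (fun t => f0 _)).
Qed.

Lemma integrable_rV_affine n (a : R) (b : 'rV[R]_n) (f : 'rV[R]_n -> R) :
  a != 0 -> integrable_rV f -> integrable_rV (fun y => f (a *: y + b)).
Proof.
move=> a0 /integrableP[mf foo]; apply/integrableP; split.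
  by apply: (@measurable_fun_rV_affine _ _ n a b (EFin \o f)).
have /= := @eintegral_rV_affine n a b (fun y => `|f y|%:E) a0.
rewrite /eintegral_rV => ->//.
  by apply: lte_mul_pinfty foo; rewrite ?lee_fin// exprn_ge0// invr_ge0.
exact: (measurableT_comp (@abse_measurable R setT) mf).
Qed.

Lemma integral_rV_affine n (a : R) (b : 'rV[R]_n) (f : 'rV[R]_n -> R) :
  a != 0 -> integrable_rV f ->
  integral_rV (fun y => f (a *: y + b)) = `|a|^-1 ^+ n * integral_rV f.
Proof.
move=> a0 intf.
set F := EFin \o f.
have IE h : (\int[lebesgue_rV R n]_t (F \o h) t =
    \int[lebesgue_rV R n]_t F^\+ (h t) - \int[lebesgue_rV R n]_t F^\- (h t))%E.
  by rewrite integralE funepos_comp funeneg_comp.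
have iF : (lebesgue_rV R n).-integrable setT (F \o @row_of R n) by exact: intf.
have mf : measurable_fun setT (F \o @row_of R n).
  by have [] := integrableP _ _ _ intf.
have mp : measurable_fun setT (F^\+%E \o @row_of R n).
  by rewrite -funepos_comp; exact: measurable_funepos.
have mn : measurable_fun setT (F^\-%E \o @row_of R n).
  by rewrite -funeneg_comp; exact: measurable_funeneg.
have Hp := eintegral_rV_affine b a0 mp (funepos_ge0 _).
have Hn := eintegral_rV_affine b a0 mn (funeneg_ge0 _).
have fp : eintegral_rV F^\+%E \is a fin_num.
  by have := integrable_pos_fin_num measurableT iF; rewrite funepos_comp.
have fn : eintegral_rV F^\-%E \is a fin_num.
  by have := integrable_neg_fin_num measurableT iF; rewrite funeneg_comp.
have E1 : integral_rV f = fine (eintegral_rV F^\+ - eintegral_rV F^\-)%E.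
  by rewrite /integral_rV /Rintegral; congr fine; exact: IE.
have E2 : integral_rV (fun y => f (a *: y + b)) =
    fine (eintegral_rV (fun y => F^\+ (a *: y + b)%R)
    - eintegral_rV (fun y => F^\- (a *: y + b)%R))%E.
  by rewrite /integral_rV /Rintegral; congr fine; exact: (IE (fun t => a *: row_of t + b)).
by rewrite E1 E2 Hp Hn -(fineK fp) -(fineK fn) -!EFinM -!EFinB mulrBr.
Qed.

End Affine.

(** * Mass of the Poisson kernel *)

Section Gauss.
Context {R : realType}.
Local Notation RT := (measurableTypeR R).
Local Notation mu := (@lebesgue_measure R).

Definition sqnorm n (y : 'rV[R]_n) : R := \sum_i y 0 i ^+ 2.

Lemma sqnorm_ge0 n (y : 'rV[R]_n) : 0 <= sqnorm y.
Proof. by apply: sumr_ge0 => i _; exact: sqr_ge0. Qed.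

Lemma sqnormZ n a (y : 'rV[R]_n) : sqnorm (a *: y) = a ^+ 2 * sqnorm y.
Proof. by rewrite mulr_sumr; apply: eq_bigr => i _; rewrite mxE exprMn. Qed.

Lemma measurable_sqnorm n : measurable_rV (@sqnorm n).
Proof.
rewrite /measurable_rV /comp /sqnorm; under eq_fun do under eq_bigr do rewrite mxE.
by apply: measurable_sum => i; apply: measurable_funX; exact: measurable_tnth.
Qed.

Lemma measurable_expR_sqnorm n (t : R) :
  measurable_fun setT (fun s : n.-tuple RT => (expR (- (t * sqnorm (row_of s))))%:E).
Proof.
apply: measurableT_comp => //; apply: measurableT_comp => //.
apply: measurableT_comp => //; apply: measurable_funM => //.
exact: measurable_sqnorm.
Qed.

Lemma integral_gauss_rV n :
  eintegral_rV (fun y : 'rV[R]_n => (expR (- sqnorm y))%:E) = (Num.sqrt pi ^+ n)%:E.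
Proof.
rewrite /eintegral_rV; elim: n => [|n IH].
  rewrite (eq_integral (cst 1%E)) => [|t _]; last first.
    by rewrite /sqnorm big_ord0 oppr0 expR0.
  by rewrite integral_cst//= diracT mule1.
rewrite ge0_integral_lebesgue_cons//=; last first.
  - by have := @measurable_expR_sqnorm n.+1 1; under eq_fun do rewrite mul1r.
transitivity (\int[mu]_x ((Num.sqrt pi ^+ n)%:E * (gauss_fun x)%:E))%E.
  apply: eq_integral => x _; rewrite -IH muleC -ge0_integralZl//=.
  - apply: eq_integral => s _; rewrite -EFinM /gauss_fun -expRD -opprD; congr (expR (- _))%:E.
    rewrite /sqnorm big_ord_recl; congr (_ + _); first by rewrite mxE tnth0.
    by apply: eq_bigr => i _; rewrite !mxE tnthS.
  - by have := @measurable_expR_sqnorm n 1; under eq_fun do rewrite mul1r.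
  - by rewrite lee_fin gauss_fun_ge0.
rewrite ge0_integralZl//=.
- by rewrite integralT_gauss -EFinM -exprSr.
- by apply/measurable_EFinP; exact: measurable_gauss_fun.
- by move=> x _; rewrite lee_fin gauss_fun_ge0.
Qed.

Lemma integral_gauss_rV_scale n (t : R) : 0 < t ->
  eintegral_rV (fun y : 'rV[R]_n => (expR (- (t * sqnorm y)))%:E) =
  ((Num.sqrt t)^-1 ^+ n * Num.sqrt pi ^+ n)%:E.
Proof.
move=> t0; rewrite EFinM -integral_gauss_rV.
have st : 0 < Num.sqrt t by rewrite sqrtr_gt0.
rewrite -[in RHS](gtr0_norm st) -(@eintegral_rV_affine _ _ _ 0) ?gt_eqF//=.
- by apply: eq_integral => s _; rewrite addr0 sqnormZ sqr_sqrtr// ltW.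
- by have := @measurable_expR_sqnorm n 1; under eq_fun do rewrite mul1r.
Qed.

(** The Gamma integrand extended by zero to the whole line, so that Tonelli and affine substitutions
    apply without a domain. *)
Definition gamma_fun (s t : R) : R := \1_(`]0, +oo[ : set RT) t * (t `^ (s - 1) * expR (- t)).

Lemma gamma_fun_ge0 s t : 0 <= gamma_fun s t.
Proof. by rewrite /gamma_fun !mulr_ge0// ?powR_ge0 ?expR_ge0// indicE. Qed.

Lemma measurable_gamma_fun s : measurable_fun [set: RT] (gamma_fun s).
Proof.
apply: measurable_funM; first exact: measurable_indic.
apply: measurable_funM; first exact: measurable_powR.
by apply: measurableT_comp => //; exact: oppr_measurable.
Qed.

(** Extended-real valued, so that finiteness need not be known beforehand; it is obtained together
    with that of the Poisson mass. *)
Definition eGamma (s : R) : \bar R := (\int[mu]_t (gamma_fun s t)%:E)%E.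

Lemma fine_eGamma s : fine (eGamma s) = Gamma s.
Proof.
rewrite /Gamma Rintegral_mkcond; congr fine; apply: eq_integral => t _.
by congr EFin; rewrite /gamma_fun patchE indicE; case: ifP => _; rewrite ?mul1r ?mul0r.
Qed.

Lemma powR_sqrt_exprn (a : R) k : 0 <= a -> Num.sqrt a ^+ k = a `^ (k%:R / 2).
Proof.
by move=> a0; rewrite -powR12_sqrt// -powR_mulrn ?powR_ge0// -powRrM mulrC.
Qed.

(** For a = 1 + |y|^2 the last factor is exp (- t |y|^2), the Gaussian in the Tonelli argument. *)
Lemma gamma_fun_scale s a t : 0 < a ->
  gamma_fun s (a * t) = a `^ (s - 1) * (gamma_fun s t * expR ((1 - a) * t)).
Proof.
move=> a0; rewrite /gamma_fun !indicE.
have -> : (a * t \in (`]0%R, +oo[%classic : set RT)) = (t \in (`]0%R, +oo[%classic : set RT)).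
  by apply/idP/idP; rewrite !inE/= !in_itv/= !andbT pmulr_rgt0.
have [|] := boolP (t \in _); last by rewrite !(mul0r, mulr0).
rewrite inE/= in_itv/= andbT => t0; rewrite !mul1r powRM ?ltW//.
rewrite -!mulrA; congr (_ * (_ * _)); rewrite -expRD; congr expR; ring.
Qed.

End Gauss.

Section PoissonMass.
Context {R : realType}.
Local Notation RT := (measurableTypeR R).
Local Notation mu := (@lebesgue_measure R).

(** Inversion is not continuous at 0, so it is written as x (x^2)^(-1) with a real power, which is
    measurable; at 0 both sides take the value 0. *)
Lemma measurable_invr : measurable_fun [set: RT] (fun x : RT => x^-1 : RT).
Proof.
rewrite (_ : (fun x => _) = fun x : R => x * (x ^+ 2) `^ (-1)); last first.
  apply/funext => x; rewrite powR_inv1 ?sqr_ge0// expr2 invfM.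
  by have [->|x0] := eqVneq x 0; rewrite ?invr0 ?mul0r// mulrA mulfV// mul1r.
apply: measurable_funM => //.
by apply: (measurableT_comp (@measurable_powR R (-1))); exact: exprn_measurable.
Qed.

Lemma measurable_sqrt : measurable_fun [set: RT] (fun x : RT => Num.sqrt x : RT).
Proof. by apply: continuous_measurable_fun; exact: sqrt_continuous. Qed.

(** The Poisson kernel of the upper half-space at height 1, without its normalising constant. *)
Definition poisson n (y : 'rV[R]_n) : R := (Num.sqrt (1 + sqnorm y))^-1 ^+ n.+1.

Lemma poisson_ge0 n (y : 'rV[R]_n) : 0 <= poisson y.
Proof. by rewrite exprn_ge0// invr_ge0 sqrtr_ge0. Qed.

Lemma measurable_poisson n : measurable_rV (@poisson n).
Proof.
apply: measurable_funX; apply: (measurableT_comp measurable_invr).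
apply: (measurableT_comp measurable_sqrt); apply: measurable_funD => //.
exact: measurable_sqnorm.
Qed.

(* Tonelli for [t^(s-1) exp (- t (1 + |y|^2))] on [0, +oo[ x R^n. *)
Lemma eGamma_mul_poisson n :
  (eGamma (n.+1%:R / 2) *
   eintegral_rV (fun y : 'rV[R]_n => (poisson y)%:E) =
   (Num.sqrt pi ^+ n)%:E * eGamma (2^-1))%E.
Proof.
set s := n.+1%:R / 2.
pose f (p : RT * n.-tuple RT) : \bar R :=
  (gamma_fun s p.1 * expR (- (p.1 * sqnorm (row_of p.2))))%:E.
have mf : measurable_fun setT f.
  apply: measurableT_comp => //; apply: measurable_funM.
    by apply: measurableT_comp => //; exact: measurable_gamma_fun.
  apply: measurableT_comp => //; apply: measurableT_comp => //.
  apply: measurable_funM => //.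
  exact: (measurableT_comp (@measurable_sqnorm R n) measurable_snd).
have mg r : measurable_fun setT (fun t : RT => (gamma_fun r t)%:E).
  by apply: measurableT_comp => //; exact: measurable_gamma_fun.
have g0 (r t : R) : (0 <= (gamma_fun r t)%:E)%E by rewrite lee_fin gamma_fun_ge0.
have f0 p : (0 <= f p)%E by rewrite lee_fin mulr_ge0// ?gamma_fun_ge0// expR_ge0.
(* Integrating in t first: the substitution by a = 1 + |y|^2 yields Gamma(s) a^(-s), that is, the
   Poisson kernel. *)
have H1 y : (\int[mu]_t f (t, y) =
    eGamma s * ((Num.sqrt (1 + sqnorm (row_of y)))^-1 ^+ n.+1)%:E)%E.
  set a := 1 + _; have a0 : 0 < a by rewrite ltr_pwDl// sqnorm_ge0.
  transitivity (\int[mu]_t ((a `^ (1 - s))%:E * (gamma_fun s (a * t + 0)%R)%:E))%E.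
    apply: eq_integral => t _; rewrite /f -EFinM addr0 gamma_fun_scale//=.
        rewrite (mulrA (a `^ _) (a `^ _)) -powRD ?(gt_eqF a0) ?implybT// addrA subrK subrr powRr0 mul1r.
    by congr (_ * expR _)%:E; rewrite /a; ring.
  have mh : measurable_fun [set: RT] (fun t : RT => a * t + 0 : RT).
    by apply: measurable_funD => //; exact: mulrl_measurable.
  have mga := measurableT_comp (mg s) mh.
  rewrite (ge0_integralZl mu measurableT mga (fun t _ => g0 s _)) ?lee_fin ?powR_ge0//.
  have := @ge0_integral_affine1 R a 0 (fun t => (gamma_fun s t)%:E).
  rewrite gt_eqF//= => ->//.
  rewrite muleA -EFinM muleC; congr (_ * _%:E)%E.
  rewrite gtr0_norm// exprVn powR_sqrt_exprn ?ltW// -powRN -/s.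
  by rewrite -powR_inv1 ?ltW// -powRD ?(gt_eqF a0) ?implybT//; congr powR; ring.
(* Integrating in y first: the Gaussian contributes t^(-n/2), and s - 1 - n/2 = 1/2 - 1 whatever n
   is. *)
have H2 t : (\int[lebesgue_rV R n]_y f (t, y) =
    (Num.sqrt pi ^+ n)%:E * (gamma_fun 2^-1 t)%:E)%E.
  have [t0|t0] := ltP 0 t; last first.
    rewrite /gamma_fun !indicE memNset/=; last by rewrite in_itv/= andbT ltNge t0.
    rewrite !mul0r mule0 [LHS]integral0_eq// => z _.
    by rewrite /f /gamma_fun indicE memNset/= ?in_itv/= ?andbT ?ltNge ?t0// !mul0r.
  under eq_integral do rewrite /f /= EFinM.
  rewrite (ge0_integralZl _ measurableT (@measurable_expR_sqnorm R n t)
    (fun y _ => _))//.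
  have := @integral_gauss_rV_scale R n t t0; rewrite /eintegral_rV => ->.
  rewrite -!EFinM; congr EFin; rewrite mulrA mulrC; congr (_ * _).
  rewrite /gamma_fun -!mulrA; congr (_ * _); rewrite mulrCA mulrC; congr (_ * _).
  rewrite exprVn powR_sqrt_exprn ?ltW// -powRN -powRD ?(gt_eqF t0) ?implybT//.
  by congr powR; rewrite /s -natr1; field.
have := @fubini_tonelli _ _ _ _ _ mu (lebesgue_rV R n) f mf f0.
under eq_integral do rewrite H2.
under [in RHS]eq_integral do rewrite H1.
rewrite (ge0_integralZl _ measurableT (mg _) (fun t _ => g0 _ t)) ?lee_fin ?exprn_ge0 ?sqrtr_ge0//.
move=> ->; rewrite ge0_integralZl//.
- by apply: measurableT_comp => //; exact: measurable_poisson.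
- by apply: integral_ge0 => t _; exact: g0.
Qed.

Lemma eGamma1 : eGamma 1 = 1%E :> \bar R.
Proof.
rewrite -(@integral_exponential_pdf R 1)//.
transitivity (\int[mu]_(t in `]0%R, +oo[) (expR (- t))%:E)%E.
  rewrite [RHS]integral_mkcond; apply: eq_integral => t _.
  rewrite /gamma_fun patchE indicE subrr; case: ifP => [|_]; last by rewrite mul0r.
  by rewrite inE/= in_itv/= andbT => t0; rewrite powRr0 !mul1r.
rewrite integral_itv_obnd_cbnd; last first.
  apply: measurable_funTS; apply: measurableT_comp => //.
  by apply: measurableT_comp => //; exact: oppr_measurable.
rewrite [LHS]integral_mkcond; apply: eq_integral => t _.
by rewrite /exponential_pdf !patchE; case: ifP => // _; rewrite mul1r mulN1r.
Qed.

Lemma integral_poisson1 : eintegral_rV (fun y : 'rV[R]_1 => (poisson y)%:E) = pi%:E.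
Proof.
have mp : measurable_fun setT (fun t : 1.-tuple RT => (poisson (row_of t))%:E).
  by apply: measurableT_comp => //; exact: measurable_poisson.
rewrite /eintegral_rV ge0_integral_lebesgue_cons//; last first.
  by move=> t; rewrite lee_fin poisson_ge0.
transitivity (\int[mu]_x ((oneDsqr x)^-1)%:E)%E.
  apply: eq_integral => x _; rewrite integral_dirac//=; last first.
    exact: (measurable_fun_pair2 x (measurableT_comp mp (@measurable_tcons R 0))).
  rewrite diracT mul1e; congr EFin.
  rewrite /poisson /sqnorm big_ord_recl big_ord0 addr0 mxE tnth0 exprVn sqr_sqrtr//.
  by rewrite addr_ge0// sqr_ge0.
rewrite ge0_symfun_integralT//=.
- rewrite (_ : [set x | _] = `[0, +oo[%classic); last first.
    by apply/seteqP; split => x/=; rewrite in_itv/= andbT.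
  by rewrite integral0y_oneDsqr -EFinM mulrCA divff// mulr1.
- exact: continuous_oneDsqrV.
- by move=> x/=; rewrite /oneDsqr sqrrN.
Qed.

(** The case n = 1 of the Tonelli identity, where Gamma(1) = 1 and the mass pi of 1/(1+x^2) are
    known, reads pi = sqrt pi Gamma(1/2). *)
Lemma eGamma_half : eGamma (2^-1) = (Num.sqrt pi)%:E :> \bar R.
Proof.
have sp : 0 < Num.sqrt (pi : R) by rewrite sqrtr_gt0 pi_gt0.
have := eGamma_mul_poisson 1; rewrite divff// eGamma1 mul1e integral_poisson1 expr1.
have : (0 <= eGamma (2^-1) :> \bar R)%E.
  by apply: integral_ge0 => t _; rewrite lee_fin gamma_fun_ge0.
case: (eGamma _) => [g _|_|//]; last by rewrite gt0_muley// lte_fin.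
rewrite -EFinM => -[/esym H]; congr EFin.
by apply: (mulfI (lt0r_neq0 sp)); rewrite H -expr2 sqr_sqrtr// pi_ge0.
Qed.

Lemma eGamma_mul_poissonE n :
  (eGamma (n.+1%:R / 2) * eintegral_rV (fun y : 'rV[R]_n => (poisson y)%:E))%E =
  (Num.sqrt pi ^+ n.+1)%:E.
Proof. by rewrite eGamma_mul_poisson eGamma_half -EFinM -exprSr. Qed.

(** A product of two nonnegative extended reals that is finite and nonzero has finite positive
    factors; a product of 0 and +oo is 0 and is excluded as well. *)
Lemma poisson_mass n : exists g p : R, [/\ 0 < g, 0 < p,
  eGamma (n.+1%:R / 2) = g%:E & eintegral_rV (fun y : 'rV[R]_n => (poisson y)%:E) = p%:E].
Proof.
have g0 : (0 <= eGamma (n.+1%:R / 2) :> \bar R)%E.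
  by apply: integral_ge0 => t _; rewrite lee_fin gamma_fun_ge0.
have p0 : (0 <= eintegral_rV (fun y : 'rV[R]_n => (poisson y)%:E))%E.
  by apply: integral_ge0 => t _; rewrite lee_fin poisson_ge0.
have sp : 0 < Num.sqrt (pi : R) ^+ n.+1 by rewrite exprn_gt0// sqrtr_gt0 pi_gt0.
have := eGamma_mul_poissonE n.
case: (eGamma _) g0 => [g g0|g0|//]; last first.
  case: (eintegral_rV _) p0 => [p p0|_|//]; last by rewrite mulyy.
  move: p0; rewrite lee_fin le_eqVlt => /predU1P[<-|p0]; last by rewrite gt0_mulye.
  by rewrite mule0 => -[H]; rewrite -H ltxx in sp.
case: (eintegral_rV _) p0 => [p p0|_|//]; last first.
  move: g0; rewrite lee_fin le_eqVlt => /predU1P[<-|g0]; last by rewrite gt0_muley.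
  by rewrite mul0e => -[H]; rewrite -H ltxx in sp.
rewrite !lee_fin in g0 p0.
rewrite -EFinM => -[H]; exists g, p; split => //.
- by rewrite lt_def g0 andbT; apply/eqP => gE; rewrite gE mul0r in H; rewrite -H ltxx in sp.
- by rewrite lt_def p0 andbT; apply/eqP => pE; rewrite pE mulr0 in H; rewrite -H ltxx in sp.
Qed.

Lemma integrable_poisson n : integrable_rV (@poisson n).
Proof.
have [g [p [_ _ _ H]]] := poisson_mass n.
apply/integrableP; split.
  by apply: measurableT_comp => //; exact: measurable_poisson.
under eq_integral => t _ do rewrite /= ger0_norm ?poisson_ge0//.
by move: H; rewrite /eintegral_rV => ->; rewrite ltry.
Qed.

Lemma integral_poisson n : integral_rV (@poisson n) = sphere_area R n.+1 / 2.
Proof.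
have [g [p [g0 _ G P]]] := poisson_mass n.
have := eGamma_mul_poissonE n; rewrite G P -EFinM => -[H].
have -> : integral_rV (@poisson n) = p.
  by rewrite /integral_rV /Rintegral; move: P; rewrite /eintegral_rV => ->.
rewrite /sphere_area -fine_eGamma G /=.
rewrite -powR_sqrt_exprn ?pi_ge0// -H.
by field; exact: lt0r_neq0.
Qed.

Lemma sphere_area_gt0 n : 0 < sphere_area R n.+1.
Proof.
have [g [p [g0 _ G P]]] := poisson_mass n.
rewrite /sphere_area -fine_eGamma G /=; apply: divr_gt0 => //.
by apply: mulr_gt0 => //; apply: powR_gt0; exact: pi_gt0.
Qed.

End PoissonMass.

(** * Dominated convergence and local integrability *)

Section IntegralTools.
Context {R : realType} {n : nat}.
Local Notation RT := (measurableTypeR R).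
Local Notation mu := (@lebesgue_measure R).
Implicit Types f g : 'rV[R]_n -> R.

Lemma integrable_rV_measurable f : integrable_rV f -> measurable_rV f.
Proof. by move=> /integrableP[mf _]; exact/measurable_EFinP. Qed.

Lemma integrable_rV_le f g : measurable_rV f -> integrable_rV g ->
  (forall y, `|f y| <= g y) -> integrable_rV f.
Proof.
move=> mf ig fg; apply: (le_integrable measurableT _ _ ig).
  by apply: measurableT_comp => //; exact: mf.
by move=> t _; rewrite lee_fin (le_trans (fg _))// ler_norm.
Qed.

Lemma integrable_rVD f g : integrable_rV f -> integrable_rV g ->
  integrable_rV (fun y => f y + g y).
Proof. by move=> fi gi; exact: (integrableD measurableT fi gi). Qed.

Lemma integrable_rVZ (k : R) f : integrable_rV f -> integrable_rV (fun y => k * f y).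
Proof. by move=> fi; exact: (integrableZl measurableT k fi). Qed.

Lemma integrable_rV0 : integrable_rV (fun _ : 'rV[R]_n => 0 : R).
Proof. exact: integrable0. Qed.

Lemma integrable_rV_sum I (r : seq I) (F : I -> 'rV[R]_n -> R) :
  (forall i, integrable_rV (F i)) -> integrable_rV (fun y => \sum_(i <- r) F i y).
Proof.
move=> Fi; elim: r => [|i r IH].
  by under eq_fun do rewrite big_nil; exact: integrable_rV0.
by under eq_fun do rewrite big_cons; exact: integrable_rVD.
Qed.

Lemma integral_rVD f g : integrable_rV f -> integrable_rV g ->
  integral_rV (fun y => f y + g y) = integral_rV f + integral_rV g.
Proof. by move=> fi gi; exact: (RintegralD measurableT fi gi). Qed.

Lemma integral_rVZ (k : R) f : integrable_rV f ->
  integral_rV (fun y => k * f y) = k * integral_rV f.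
Proof. by move=> fi; exact: (RintegralZl k measurableT fi). Qed.

Lemma integral_rV0 : integral_rV (fun _ : 'rV[R]_n => 0 : R) = 0 :> R.
Proof. by rewrite /integral_rV /Rintegral integral0. Qed.

Lemma integral_rVN f : integrable_rV f -> integral_rV (fun y => - f y) = - integral_rV f.
Proof.
move=> fi; rewrite -mulN1r -integral_rVZ//; congr integral_rV.
by apply/funext => y; rewrite mulN1r.
Qed.

Lemma integral_rV_sum I (r : seq I) (F : I -> 'rV[R]_n -> R) :
  (forall i, integrable_rV (F i)) ->
  integral_rV (fun y => \sum_(i <- r) F i y) = \sum_(i <- r) integral_rV (F i).
Proof.
move=> Fi; elim: r => [|i r IH].
  by under eq_fun do rewrite big_nil; rewrite big_nil integral_rV0.
under eq_fun do rewrite big_cons; rewrite big_cons integral_rVD// ?IH//.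
exact: integrable_rV_sum.
Qed.

Lemma le_norm_integral_rV f g : integrable_rV f -> integrable_rV g ->
  (forall y, `|f y| <= g y) -> `|integral_rV f| <= integral_rV g.
Proof.
move=> fi gi fg; apply: (le_trans (le_normr_Rintegral measurableT fi)).
apply: (le_Rintegral measurableT _ gi) => [|t _]; last exact: fg.
exact: (integrable_norm fi).
Qed.

(** Dominated convergence is sequential; one-sided limits are tested along positive sequences
    tending to 0. *)
Lemma dominated_cvg_at_right (F : R -> 'rV[R]_n -> R) f g :
  (forall t, 0 < t <= 1 -> measurable_rV (F t)) ->
  (forall y, F t y @[t --> 0^'+] --> f y) ->
  integrable_rV g ->
  (forall t y, 0 < t <= 1 -> `|F t y| <= g y) ->
  integrable_rV f /\ integral_rV (F t) @[t --> 0^'+] --> integral_rV f.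
Proof.
move=> mF Ff ig Fg.
have main (u : R^nat) : (forall k, 0 < u k) -> u k @[k --> \oo] --> (0 : R) ->
    integrable_rV f /\ integral_rV (F (u k)) @[k --> \oo] --> integral_rV f.
  (* The hypotheses hold only for t <= 1, so the sequence is capped at 1; this changes finitely many
     terms. *)
  move=> u0 ucv; pose v k := Num.min (u k) 1.
  have v01 k : 0 < v k <= 1 by rewrite /v lt_min u0 ltr01 ge_min lexx orbT.
  have vu : \forall k \near \oo, v k = u k.
    near=> k; rewrite /v; apply/min_idPl; apply: ltW.
    near: k; exact: (cvgr_lt 0).
  have vcv : v k @[k --> \oo] --> (0 : R).
    by apply: cvg_trans ucv; apply: near_eq_cvg; near do apply/esym.
  have Fv y : F (v k) y @[k --> \oo] --> f y.
    by have /cvg_at_rightP := Ff y; apply; split => // k; have /andP[] := v01 k.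
  have mv k : measurable_fun setT (fun t : n.-tuple RT => (F (v k) (row_of t))%:E).
    by apply: measurableT_comp => //; exact: (mF _ (v01 k)).
  have fv (t : n.-tuple RT) : (F (v k) (row_of t))%:E @[k --> \oo] --> (f (row_of t))%:E.
    by apply: cvg_EFin; [exact: nearW|exact: Fv].
  have mf : measurable_fun setT (fun t : n.-tuple RT => (f (row_of t))%:E).
    by apply: (emeasurable_fun_cvg _ _ mv) => t _; exact: fv.
  have [fi _ H] : [/\ (lebesgue_rV R n).-integrable setT (fun t => (f (row_of t))%:E),
     (\int[lebesgue_rV R n]_t `|(F (v k) (row_of t))%:E - (f (row_of t))%:E|)%E @[k --> \oo] --> 0%E &
     (\int[lebesgue_rV R n]_t (F (v k) (row_of t))%:E)%E @[k --> \oo] -->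
      (\int[lebesgue_rV R n]_t (f (row_of t))%:E)%E].
    apply: (dominated_convergence measurableT mv mf _ ig).
      by apply: aeW => t _; exact: fv.
    by apply: aeW => t k _; rewrite lee_fin; exact: Fg.
  split; first exact: fi.
  have {}H : integral_rV (F (v k)) @[k --> \oo] --> integral_rV f.
    by apply: fine_cvg; rewrite fineK//; exact: (integrable_fin_num measurableT fi).
  apply: cvg_trans H; apply: near_eq_cvg.
  by near=> k; congr integral_rV; congr F; near: k.
(* Integrability of the limit does not depend on the sequence, so one concrete sequence provides
   it. *)
have [fi _] : integrable_rV f /\ integral_rV (F (k.+1%:R^-1)) @[k --> \oo] --> integral_rV f.
  apply: (main (fun k => k.+1%:R^-1)) => [k|]; first by rewrite invr_gt0.
  exact: cvg_harmonic.
split => //; apply/cvg_at_rightP => u [u0 ucv].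
by have [] := main u u0 ucv.
Unshelve. all: by end_near. Qed.
End IntegralTools.

(** * The Poisson kernel at height t as an approximate identity *)

Section RadialKernel.
Context {R : realType}.
Local Notation RT := (measurableTypeR R).
Local Notation mu := (@lebesgue_measure R).

Lemma measurable_rVM n (f g : 'rV[R]_n -> R) : measurable_rV f -> measurable_rV g ->
  measurable_rV (fun y => f y * g y).
Proof. by move=> mf mg; exact: (measurable_funM mf mg). Qed.

Lemma measurable_rVB n (f g : 'rV[R]_n -> R) : measurable_rV f -> measurable_rV g ->
  measurable_rV (fun y => f y - g y).
Proof. by move=> mf mg; exact: (measurable_funB mf mg). Qed.

Lemma measurable_rVX n (f : 'rV[R]_n -> R) k : measurable_rV f ->
  measurable_rV (fun y => f y ^+ k).
Proof. by move=> mf; exact: (measurable_funX k mf). Qed.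

Lemma measurable_rV_cst n (c : R) : measurable_rV (fun _ : 'rV[R]_n => c).
Proof. exact: measurable_cst. Qed.

Lemma measurable_rV_coord n (i : 'I_n) : measurable_rV (fun y : 'rV[R]_n => y 0 i).
Proof.
rewrite /measurable_rV /comp; under eq_fun do rewrite mxE.
exact: measurable_tnth.
Qed.

(** This is 1/|x| at the point x = (t, y). *)
Definition radial_inv n (t : R) (y : 'rV[R]_n) : R := (Num.sqrt (t ^+ 2 + sqnorm y))^-1.

Lemma radial_inv_ge0 n t (y : 'rV[R]_n) : 0 <= radial_inv t y.
Proof. by rewrite invr_ge0 sqrtr_ge0. Qed.

Lemma measurable_radial_inv n t : measurable_rV (@radial_inv n t).
Proof.
apply: (measurableT_comp measurable_invr); apply: (measurableT_comp measurable_sqrt).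
by apply: measurable_funD => //; exact: measurable_sqnorm.
Qed.

Lemma radial_inv_le n t (y : 'rV[R]_n) : 0 < enorm y -> radial_inv t y <= (enorm y)^-1.
Proof.
move=> y0; rewrite lef_pV2 ?posrE//; last first.
  by rewrite sqrtr_gt0 ltr_wpDl ?sqr_ge0// -sqrtr_gt0.
by apply: ler_wsqrtr; rewrite lerDr sqr_ge0.
Qed.

(** Homogeneity: t^2 factors out of the root, so the kernel at height t is a dilate of that at
    height 1 and has the same mass. *)
Lemma radial_poisson n t (y : 'rV[R]_n) : 0 < t ->
  t * radial_inv t y ^+ n.+1 = t^-1 ^+ n * poisson (t^-1 *: y).
Proof.
move=> t0; rewrite /radial_inv /poisson sqnormZ.
have -> : t ^+ 2 + sqnorm y = t ^+ 2 * (1 + t^-1 ^+ 2 * sqnorm y).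
  by field; exact: lt0r_neq0.
rewrite sqrtrM ?sqr_ge0// sqrtr_sqr gtr0_norm// invfM exprMn mulrA exprS mulrA.
by rewrite mulfV ?mul1r// lt0r_neq0.
Qed.

Lemma integrable_radial n t : 0 < t ->
  integrable_rV (fun y : 'rV[R]_n => t * radial_inv t y ^+ n.+1).
Proof.
move=> t0; under eq_fun do rewrite radial_poisson//.
apply: integrable_rVZ.
have := @integrable_rV_affine R n t^-1 0 (@poisson R n).
under eq_fun do rewrite addr0; apply; first by rewrite invr_eq0 lt0r_neq0.
exact: integrable_poisson.
Qed.

Lemma integral_radial n t : 0 < t ->
  integral_rV (fun y : 'rV[R]_n => t * radial_inv t y ^+ n.+1) = sphere_area R n.+1 / 2.
Proof.
move=> t0; under eq_fun do rewrite radial_poisson//.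
have tn0 : t^-1 != 0 by rewrite invr_eq0 lt0r_neq0.
have := integral_rV_affine 0 tn0 (@integrable_poisson R n).
under eq_fun do rewrite addr0; move=> H.
rewrite integral_rVZ; last first.
  have := integrable_rV_affine 0 tn0 (@integrable_poisson R n).
  by under eq_fun do rewrite addr0.
rewrite H integral_poisson gtr0_norm ?invr_gt0// invrK mulrA -exprMn mulVf ?expr1n ?mul1r//.
exact: lt0r_neq0.
Qed.

Lemma integrable_radialM n t (f : 'rV[R]_n -> R) M : 0 < t ->
  measurable_rV f -> (forall y, `|f y| <= M) ->
  integrable_rV (fun y => t * radial_inv t y ^+ n.+1 * f y).
Proof.
move=> t0 mf fM; have mr := integrable_rV_measurable (integrable_radial n t0).
apply: (integrable_rV_le (measurable_rVM mr mf) (integrable_rVZ M (integrable_radial n t0))).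
move=> y; rewrite normrM mulrC ler_pM//.
by rewrite ger0_norm// mulr_ge0 ?exprn_ge0 ?radial_inv_ge0// ltW.
Qed.

(** The substitution y = t z fixes the kernel and moves t into the argument of [f]; then M times the
    Poisson kernel dominates, and continuity at 0 suffices. *)
Lemma poisson_approx n (f : 'rV[R]_n -> R) M : measurable_rV f ->
  (forall y, `|f y| <= M) -> {for 0, continuous f} ->
  integral_rV (fun y => t * radial_inv t y ^+ n.+1 * f y) @[t --> 0^'+] -->
  sphere_area R n.+1 / 2 * f 0.
Proof.
move=> mf fM cf.
have E t : 0 < t -> integral_rV (fun y => t * radial_inv t y ^+ n.+1 * f y) =
    integral_rV (fun z => poisson z * f (t *: z + 0)).
  move=> t0; have tn0 : t != 0 by exact: lt0r_neq0.
  have ti : t^-1 != 0 by rewrite invr_eq0.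
  have := integral_rV_affine 0 tn0 (integrable_radialM t0 mf fM).
  rewrite gtr0_norm// => H.
  apply: (mulfI (expf_neq0 n ti)); rewrite -{}H -integral_rVZ; last first.
    apply: (integrable_rV_le _ (integrable_rVZ M (integrable_poisson n))).
      apply: measurable_rVM; first exact: measurable_poisson.
      exact: measurable_fun_rV_affine.
    by move=> y; rewrite normrM mulrC ler_pM// ger0_norm// poisson_ge0.
  congr integral_rV; apply/funext => z.
  by rewrite radial_poisson// addr0 scalerA mulVf// scale1r mulrA.
have -> : sphere_area R n.+1 / 2 * f 0 = integral_rV (fun z : 'rV[R]_n => poisson z * f 0).
  rewrite -integral_poisson mulrC -integral_rVZ; last exact: integrable_poisson.
  by congr integral_rV; apply/funext => z; rewrite mulrC.
have [] := @dominated_cvg_at_right R n (fun t z => poisson z * f (t *: z + 0))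
  (fun z => poisson z * f 0) (fun z => M * poisson z).
- move=> t /andP[t0 _]; apply: measurable_rVM; first exact: measurable_poisson.
  exact: measurable_fun_rV_affine.
- move=> y; apply: cvgM; first exact: cvg_cst.
  apply: continuous_cvg => //.
  rewrite -[X in _ --> X]addr0; apply: cvgD; last exact: cvg_cst.
  rewrite -[X in _ --> X](scale0r y); apply: cvgZl.
  by apply: cvg_at_right_filter; exact: cvg_id.
- exact/integrable_rVZ/integrable_poisson.
- by move=> t y _; rewrite normrM mulrC ler_pM// ger0_norm// poisson_ge0.
move=> _ H; apply: cvg_trans H; apply: near_eq_cvg; near=> t; apply/esym/E.
by near: t; exact: nbhs_right_gt.
Unshelve. all: by end_near. Qed.

End RadialKernel.

(** * Local integrability of |y|^(1-n) *)

Section LocallyIntegrable.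
Context {R : realType}.
Local Notation RT := (measurableTypeR R).
Local Notation mu := (@lebesgue_measure R).

(* Equal to [|y|^(1-n)] on the ball of radius [rho] off the origin; the factor [|y|^2] makes it
   vanish at [0], also for [n = 1]. *)
Definition riesz n (rho : R) (y : 'rV[R]_n) : R :=
  (enorm y <= rho)%R%:R * (enorm y ^+ 2 * (enorm y)^-1 ^+ n.+1).

Lemma enorm_ge0 n (y : 'rV[R]_n) : 0 <= enorm y.
Proof. exact: sqrtr_ge0. Qed.

Lemma measurable_enorm n : measurable_rV (@enorm R n).
Proof. by apply: (measurableT_comp measurable_sqrt); exact: measurable_sqnorm. Qed.

Lemma measurable_enorm_inv n : measurable_rV (fun y : 'rV[R]_n => (enorm y)^-1).
Proof. by apply: (measurableT_comp measurable_invr); exact: measurable_enorm. Qed.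

Lemma riesz_ge0 n rho (y : 'rV[R]_n) : 0 <= riesz rho y.
Proof. by rewrite mulr_ge0// mulr_ge0 ?exprn_ge0 ?invr_ge0 ?enorm_ge0. Qed.

Lemma measurable_rV_if n (f g : 'rV[R]_n -> R) (P : 'rV[R]_n -> bool) :
  measurable_fun setT (P \o row_of) -> measurable_rV f -> measurable_rV g ->
  measurable_rV (fun y => if P y then f y else g y).
Proof.
by move=> mP mf mg; apply: measurable_fun_ifT.
Qed.

Lemma measurable_riesz n rho : measurable_rV (@riesz n rho).
Proof.
rewrite (_ : @riesz n rho = fun y => if enorm y <= rho then
   enorm y ^+ 2 * (enorm y)^-1 ^+ n.+1 else 0); last first.
  by apply/funext => y; rewrite /riesz; case: ifP; rewrite ?mul1r ?mul0r.
apply: measurable_rV_if; last exact: measurable_rV_cst.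
  by apply: measurable_fun_ler => //; exact: measurable_enorm.
apply: measurable_rVM; apply: measurable_rVX; first exact: measurable_enorm.
exact: measurable_enorm_inv.
Qed.

(* On [r < t <= 2 r], where [r = |y|], the Poisson kernel is at least a multiple of [r^-n]. *)
Lemma integrable_riesz n rho : 0 < rho -> integrable_rV (@riesz n rho).
Proof.
move=> rho0.
(* Heights up to 2 rho, so that ]r, 2 r] is covered for every r <= rho. *)
pose I : RT -> R := \1_(`]0, (2 * rho)]%classic : set R).
pose F (p : RT * n.-tuple RT) : \bar R :=
  (I p.1 * (p.1 * radial_inv p.1 (row_of p.2) ^+ n.+1))%:E.
have mI : measurable_fun setT I by exact: measurable_indic.
have I0 t : 0 <= I t by rewrite /I indicE.
have mF : measurable_fun setT F.
  apply: measurableT_comp => //; apply: measurable_funM.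
    exact: (measurableT_comp mI measurable_fst).
  apply: measurable_funM => //; apply: measurable_funX.
  apply: (measurableT_comp measurable_invr); apply: (measurableT_comp measurable_sqrt).
  apply: measurable_funD; first exact: measurable_funX.
  exact: (measurableT_comp (@measurable_sqnorm R n) measurable_snd).
have F0 p : (0 <= F p)%E.
  rewrite lee_fin /F /I indicE; have [|_] := boolP (p.1 \in _); last by rewrite mul0r.
  rewrite inE/= in_itv/= => /andP[p0 _].
  by rewrite mul1r mulr_ge0 ?exprn_ge0 ?radial_inv_ge0// ltW.
have := fubini_tonelli (m1 := mu) (m2 := lebesgue_rV R n) F mF F0.
(* All slices have the same mass sigma/2, so the double integral is that mass times the length 2
   rho. *)
have -> : (\int[mu]_t \int[lebesgue_rV R n]_y F (t, y) =
    \int[mu]_t ((sphere_area R n.+1 / 2)%:E * (I t)%:E))%E.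
  apply: eq_integral => t _; rewrite /F /=.
  have [tI|tI] := boolP (t \in (`]0, (2 * rho)]%classic : set R)); last first.
    rewrite /I indicE (negbTE tI) mule0 integral0_eq// => y _.
    by rewrite mul0r.
  have t0 : 0 < t by move: tI; rewrite inE/= in_itv/= => /andP[].
  rewrite /I indicE tI mule1 -(integral_radial n t0) fineK//; last first.
    exact: (integrable_fin_num measurableT (integrable_radial n t0)).
  by apply: eq_integral => y _; rewrite mul1r.
rewrite ge0_integralZl//=; last 3 first.
- by apply: measurableT_comp.
- by move=> t _; rewrite lee_fin.
- by rewrite lee_fin divr_ge0// ltW// sphere_area_gt0.
rewrite integral_indic// setIT/= lebesgue_measure_itv/= lte_fin mulr_gt0// => H.
(* For r < t <= 2 r one has t^2 + r^2 <= 5 r^2. *)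
pose c : R := (Num.sqrt 5)^-1 ^+ n.+1.
have c0 : 0 < c by rewrite exprn_gt0// invr_gt0 sqrtr_gt0.
have low (y : n.-tuple RT) : ((c * riesz rho (row_of y))%:E <= \int[mu]_t F (t, y))%E.
  rewrite /riesz; set r := enorm _.
  have [rrho|] := leP r rho; last by rewrite mul0r mulr0 integral_ge0.
  have : 0 <= r by exact: enorm_ge0.
  rewrite le_eqVlt => /predU1P[<-|r0].
    by rewrite expr0n /= mul0r !mulr0 integral_ge0.
  pose J : RT -> R := \1_(`]r, (2 * r)]%classic : set R).
  have mJ : measurable_fun setT J by exact: measurable_indic.
  apply: (@le_trans _ _ (\int[mu]_t ((c * (r * r^-1 ^+ n.+1))%:E * (J t)%:E))%E).
    rewrite ge0_integralZl//=; last 3 first.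
    - by apply: measurableT_comp.
    - by move=> t _; rewrite lee_fin /J indicE.
    - by rewrite lee_fin !mulr_ge0 ?exprn_ge0 ?invr_ge0// ltW.
    rewrite integral_indic// setIT/= lebesgue_measure_itv/= lte_fin.
    rewrite ltr_pMl// ltr1n -EFinB -EFinM lee_fin mul1r expr2.
    by rewrite [leRHS](_ : _ = c * (r * r * r^-1 ^+ n.+1))//; ring.
  apply: ge0_le_integral => //.
  - by move=> t _; rewrite -EFinM lee_fin !mulr_ge0 ?exprn_ge0 ?invr_ge0 ?sqrtr_ge0//
      ?ltW// /J indicE.
  - by apply: measurable_funeM; apply: measurableT_comp.
  - exact: (measurable_fun_pair1 y mF).
  move=> t _; rewrite -EFinM /F lee_fin /J !indicE.
  have [|_] := boolP (t \in (`]r, (2 * r)]%classic : set R)); last first.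
    by rewrite mulr0 -lee_fin; exact: F0.
  rewrite inE/= in_itv/= => /andP[rt t2r].
  rewrite /I indicE mem_set ?mulr1 ?mul1r/=; last first.
    by rewrite in_itv/= (lt_trans r0 rt) (le_trans t2r)// ler_pM2l.
  rewrite /c mulrCA ler_pM//; [exact: ltW| |exact: ltW|].
    by rewrite mulr_ge0 ?exprn_ge0 ?invr_ge0// ?sqrtr_ge0// ltW.
  rewrite -exprMn lerXn2r ?nnegrE ?mulr_ge0 ?invr_ge0 ?sqrtr_ge0 ?(ltW r0)//.
  rewrite -invfM lef_pV2 ?posrE.
  - rewrite -[r in leRHS]gtr0_norm// -sqrtr_sqr -sqrtrM// ler_wsqrtr//.
    have -> : sqnorm (row_of y) = r ^+ 2 by rewrite sqr_sqrtr// sqnorm_ge0.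
    by have := ler_pM (ltW (lt_trans r0 rt)) (ltW (lt_trans r0 rt)) t2r t2r; lra.
  - by rewrite mulr_gt0// sqrtr_gt0.
  - by rewrite sqrtr_gt0 ltr_pwDl ?sqnorm_ge0// exprn_gt0// (lt_trans r0)//.
have {}H : (\int[lebesgue_rV R n]_y (c * riesz rho (row_of y))%:E < +oo)%E.
  apply: (@le_lt_trans _ _ (\int[lebesgue_rV R n]_y \int[mu]_t F (t, y))%E).
    apply: ge0_le_integral => //.
    - by move=> y _; rewrite lee_fin mulr_ge0 ?riesz_ge0// ltW.
    - apply: measurableT_comp => //; apply: measurable_funM => //.
      exact: measurable_riesz.
    - by apply: (measurable_fun_fubini_tonelli_G (m1 := mu) F).
  by rewrite -H -EFinB -EFinM ltry.
have ci : integrable_rV (fun y => c * @riesz n rho y).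
  apply/integrableP; split.
    apply: measurableT_comp => //; apply: measurable_funM => //.
    exact: measurable_riesz.
  rewrite (eq_integral (fun t : n.-tuple RT => (c * riesz rho (row_of t))%:E)) => [|t _].
    exact: H.
  by rewrite /= ger0_norm// mulr_ge0 ?riesz_ge0// ltW.
have -> : @riesz n rho = fun y => c^-1 * (c * riesz rho y).
  by apply/funext => y; rewrite mulrA mulVf ?mul1r// lt0r_neq0.
exact: integrable_rVZ.
Qed.

End LocallyIntegrable.

(** * Calculus on R^n and integration by parts *)

Section DifferentialTools.
Context {R : realType} {n : nat}.
Implicit Types (f g : 'rV[R]_n -> R) (x y v : 'rV[R]_n).

Lemma derive_along f a v (s : R) : differentiable f (a + s *: v) ->
  is_derive s 1 (fun t : R => f (a + t *: v)) ('D_v f (a + s *: v)).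
Proof.
move=> df.
have E : (fun h : R => h^-1 *: (((fun t : R => f (a + t *: v)) \o shift s) (h *: 1) - f (a + s *: v)))
   = (fun h : R => h^-1 *: ((f \o shift (a + s *: v)) (h *: v) - f (a + s *: v))).
  apply/funext => h /=; congr (_ *: (f _ - _)).
  by rewrite [h *: 1]mulr1 scalerDl addrCA.
have := @diff_derivable _ _ _ f (a + s *: v) v df.
by rewrite /derivable => dv; split; [rewrite /derivable E|rewrite /derive E].
Qed.

Lemma mean_value_rV f a v : (forall x, differentiable f x) ->
  exists c : R, f (a + v) - f a = 'D_v f (a + c *: v).
Proof.
move=> df.
have [] := @MVT R (fun t : R => f (a + t *: v)) (fun s => 'D_v f (a + s *: v)) 0 1 ltr01.
- by move=> s _; exact: derive_along.
- apply: continuous_subspaceT => s.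
  by apply/differentiable_continuous/derivable1_diffP; have [] := @derive_along f a v s (df _).
move=> c _; rewrite scale0r addr0 scale1r subr0 mulr1 => H.
by exists c.
Qed.

Lemma derive_partialE f x v : differentiable f x ->
  'D_v f x = \sum_i v 0 i * partial i f x.
Proof.
move=> df; rewrite deriveE// {1}(row_sum_delta v) linear_sum; apply: eq_bigr => i _.
by rewrite linearZ /partial deriveE.
Qed.

Lemma coord_le_enorm v i : `|v 0 i| <= enorm v.
Proof.
rewrite -sqrtr_sqr ler_wsqrtr// (bigD1 i)//= lerDl.
by apply: sumr_ge0 => j _; exact: sqr_ge0.
Qed.

Lemma derive_le f x v (B : R) : differentiable f x -> 
  (forall i, `|partial i f x| <= B) -> `|'D_v f x| <= n%:R * B * enorm v.
Proof.
move=> df fB; rewrite derive_partialE//.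
apply: (le_trans (ler_norm_sum _ _ _)).
rewrite (_ : n%:R * B * enorm v = \sum_(i < n) enorm v * B); last first.
  by rewrite sumr_const card_ord -mulr_natl; ring.
by apply: ler_sum => i _; rewrite normrM ler_pM// coord_le_enorm.
Qed.

Lemma is_derive_coord x v i : is_derive x v (fun y : 'rV[R]_n => y 0 i) (v 0 i).
Proof.
have lc : linear (fun y : 'rV[R]_n => y 0 i : R) by move=> k y z; rewrite !mxE.
pose c : {linear 'rV[R]_n -> R} := HB.pack (fun y : 'rV[R]_n => y 0 i)
  (GRing.isLinear.Build _ _ _ _ _ lc).
have cc : continuous c by exact: coord_continuous.
have dc : differentiable c x by exact/linear_differentiable.
split; first exact: (@diff_derivable _ _ _ c x v dc).
by rewrite (@deriveE _ _ _ c x v dc) diff_lin.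
Qed.

Lemma sqnormE : @sqnorm R n = \sum_i (fun y : 'rV[R]_n => y 0 i) ^+ 2.
Proof. by apply/funext => y; rewrite fct_sumE. Qed.

Lemma differentiable_sqnorm x : differentiable (@sqnorm R n) x.
Proof.
rewrite sqnormE; apply: differentiable_sum => i; apply: differentiableX.
exact: differentiable_coord.
Qed.

Lemma partial_sqnorm i x : partial i (@sqnorm R n) x = 2 * x 0 i.
Proof.
rewrite /partial sqnormE derive_sum => [|j]; last first.
  by apply: derivableX; have [] := is_derive_coord x (delta_mx 0 i) j.
rewrite (bigD1 i)//= big1 => [|j ji].
  have [d1 d2] := is_derive_coord x (delta_mx 0 i) i.
  by rewrite deriveX// d2 mxE !eqxx addr0 expr1 [LHS]mulr1.
have [d1 d2] := is_derive_coord x (delta_mx 0 i) j.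
by rewrite deriveX// d2 mxE eqxx (negPf ji) scaler0.
Qed.

Lemma enorm_continuous : continuous (@enorm R n).
Proof.
move=> y; apply: (@continuous_comp _ _ _ (@sqnorm R n)); last exact: sqrt_continuous.
exact/differentiable_continuous/differentiable_sqnorm.
Qed.

Lemma continuous_bounded_on (K : set 'rV[R]_n) g : compact K -> continuous g ->
  exists2 M : R, 0 < M & forall y, K y -> `|g y| <= M.
Proof.
move=> cK cg.
have cgK : compact (g @` K).
  by apply: continuous_compact => //; exact: continuous_subspaceT.
have [M [Mr MK]] := compact_bounded cgK.
exists (Num.max M 0 + 1); first by rewrite ltr_wpDl// le_max lexx orbT.
move=> y Ky; apply: (MK (Num.max M 0 + 1)).
  by rewrite (le_lt_trans (_ : _ <= Num.max M 0)) ?le_max ?lexx// ltrDl.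
by exists y.
Qed.

Lemma supportedP (K : set 'rV[R]_n) f y : supported_in K f -> f y != 0 -> K y.
Proof. by move=> sK fy; apply: sK; exact: subset_closure. Qed.

Lemma supported_bounded (K : set 'rV[R]_n) f : compact K -> supported_in K f -> continuous f ->
  exists2 M : R, 0 < M & forall y, `|f y| <= M.
Proof.
move=> cK sK cf; have [M M0 H] := continuous_bounded_on cK cf; exists M => // y.
have [->|fy] := eqVneq (f y) 0; first by rewrite normr0 ltW.
exact/H/(supportedP sK).
Qed.

Lemma supported_radius (K : set 'rV[R]_n) : compact K ->
  exists2 rho : R, 0 < rho & forall f, supported_in K f -> forall y, f y != 0 -> enorm y <= rho.
Proof.
move=> cK; have [M M0 H] := continuous_bounded_on cK enorm_continuous.
exists M => // f sK y fy; apply: (le_trans (ler_norm _)).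
exact/H/(supportedP sK).
Qed.

Lemma partial_eq0 (K : set 'rV[R]_n) f j y : supported_in K f -> ~ K y -> partial j f y = 0.
Proof.
move=> sK Ky.
have Sy : \forall z \near y, f z = cst 0 z.
  have : nbhs y (~` closure [set x | f x != 0]).
    by apply: open_nbhs_nbhs; split; [exact/closed_openC/closed_closure|move/sK].
  apply: filterS => z Sz; apply/eqP; apply: contra_notT Sz => fz.
  exact: subset_closure.
by rewrite /partial (@near_eq_derive _ _ _ f (cst 0))// derive_cst.
Qed.
End DifferentialTools.

Section IntegrationByParts.
Context {R : realType} {n : nat}.
Implicit Types (f g : 'rV[R]_n -> R) (x y v : 'rV[R]_n).

(** On the ball the Poisson kernel is bounded below, so a multiple of it dominates the indicator and
    no volume has to be computed. *)
Lemma integrable_ball (rho : R) : integrable_rV (fun y : 'rV[R]_n => (enorm y <= rho)%R%:R : R).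
Proof.
pose c : R := (Num.sqrt (1 + rho ^+ 2)) ^+ n.+1.
apply: (@integrable_rV_le R n _ (fun y => c * poisson y)).
- rewrite (_ : (fun y => _) = fun y => if enorm y <= rho then 1 else 0); last first.
    by apply/funext => y; case: ifP.
  apply: measurable_rV_if; [|exact: measurable_rV_cst|exact: measurable_rV_cst].
  by apply: measurable_fun_ler => //; exact: measurable_enorm.
- exact/integrable_rVZ/integrable_poisson.
move=> y; rewrite normr_nat; have [yr|_] := leP (enorm y) rho; last first.
  by rewrite mulr_ge0 ?poisson_ge0// exprn_ge0// sqrtr_ge0.
have pos : 0 < Num.sqrt (1 + sqnorm y) by rewrite sqrtr_gt0 ltr_pwDl// sqnorm_ge0.
rewrite /c /poisson -exprMn exprn_ege1// ler_pdivlMr// mul1r ler_wsqrtr// lerD2l.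
have -> : sqnorm y = enorm y ^+ 2 by rewrite sqr_sqrtr// sqnorm_ge0.
by rewrite lerXn2r// ?nnegrE ?enorm_ge0// (le_trans (enorm_ge0 y)).
Qed.

Lemma integrable_bounded f (M rho : R) : measurable_rV f -> (forall y, `|f y| <= M) ->
  (forall y, f y != 0 -> enorm y <= rho) -> integrable_rV f.
Proof.
move=> mf fM fr; apply: (integrable_rV_le mf (integrable_rVZ M (integrable_ball rho))).
move=> y; have [->|fy] := eqVneq (f y) 0; last by rewrite fr// mulr1.
by rewrite normr0 mulr_ge0// (le_trans _ (fM y)).
Qed.

Lemma integrable_continuous (K : set 'rV[R]_n) f : compact K -> supported_in K f ->
  continuous f -> integrable_rV f.
Proof.
move=> cK sK cf; have [M _ fM] := supported_bounded cK sK cf.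
have [rho _ H] := supported_radius cK.
exact: (integrable_bounded (continuous_measurable_rV cf) fM (H _ sK)).
Qed.

Lemma sqnorm_shift y v : sqnorm y <= 2 * sqnorm (y + v) + 2 * sqnorm v.
Proof.
rewrite /sqnorm !mulr_sumr -big_split /=; apply: ler_sum => i _; rewrite mxE.
(* This square is exactly the difference of the two sides. *)
have := sqr_ge0 (y 0 i + 2 * v 0 i); nra.
Qed.

(* The difference quotients of [f] have integral zero, by translation invariance. *)
Lemma integral_partial_eq0 (K : set 'rV[R]_n) f j : compact K -> supported_in K f ->
  (forall x, differentiable f x) -> continuous (partial j f) ->
  integral_rV (partial j f) = 0.
Proof.
move=> cK sK df cp.
have cf : continuous f by move=> x; exact: differentiable_continuous.
have fi := integrable_continuous cK sK cf.
have sKp : supported_in K (partial j f).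
  have Kcl : closed K by apply: compact_closed cK; exact: norm_hausdorff.
  rewrite /supported_in [X in _ `<=` X]((closure_id K).1 Kcl); apply: closure_subset => y /= /eqP py.
  by apply: contrapT => /(partial_eq0 j sK).
have [M M0 pM] := supported_bounded cK sKp cp.
have [rho rho0 Hrho] := supported_radius cK.
pose F (h : R) y := h^-1 * (f (1 *: y + h *: delta_mx 0 j) - f y).
have mt h : measurable_rV (fun y => f (1 *: y + h *: delta_mx 0 j)).
  exact: (measurable_fun_rV_affine 1 _ (continuous_measurable_rV cf)).
(* If |y| exceeds this radius, [sqnorm_shift] keeps both y and its translate by t <= 1 outside the
   ball of radius rho, so the difference quotient vanishes. *)
pose rho' := Num.sqrt (2 * rho ^+ 2 + 2).
have [] := @dominated_cvg_at_right R n F (partial j f) (fun y => M * (enorm y <= rho')%R%:R).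
- move=> t _; apply: measurable_rVM; first exact: measurable_rV_cst.
  by apply: measurable_rVB; [exact: mt|exact: continuous_measurable_rV].
- move=> y; rewrite /F.
  have H : h^-1 *: ((f \o shift y) (h *: delta_mx 0 j) - f y) @[h --> 0^'] --> partial j f y.
    by have : derivable f y (delta_mx 0 j) by exact: diff_derivable.
  have {}H := cvg_dnbhs_at_right H.
  apply: cvg_trans H; apply: near_eq_cvg; near=> h.
  by rewrite /= scale1r [y + _]addrC.
- exact/integrable_rVZ/integrable_ball.
- move=> t y /andP[t0 t1]; rewrite /F scale1r.
  set q := y + t *: delta_mx 0 j.
  have [yr|ry] := leP (enorm y) rho'.
    have [c ->] := mean_value_rV y (t *: delta_mx 0 j) df.
    rewrite (_ : 'D_(t *: delta_mx 0 j) f _ = t * partial j f (y + c *: (t *: delta_mx 0 j))).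
      by rewrite mulr1 mulKf ?lt0r_neq0.
    by rewrite /partial !deriveE// linearZ.
  have sq2 : sqnorm (t *: delta_mx 0 j : 'rV[R]_n) = t ^+ 2.
    rewrite sqnormZ /sqnorm (bigD1 j)//= big1 => [|i ij]; rewrite mxE ?eqxx ?(negPf ij) ?expr0n//.
    by rewrite addr0 expr1n mulr1.
  have fy0 : f y = 0.
    apply/eqP; apply: contraTT ry => fy; rewrite -leNgt.
    rewrite (le_trans (Hrho f sK y fy))// -[leLHS]gtr0_norm// -sqrtr_sqr ler_wsqrtr//.
    by have := sqr_ge0 rho; lra.
  have fq0 : f q = 0.
    apply/eqP; apply: contraTT ry => fq; rewrite -leNgt ler_wsqrtr//.
    have := sqnorm_shift y (t *: delta_mx 0 j); rewrite sq2 -/q.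
    have := Hrho f sK q fq.
    have -> : sqnorm q = enorm q ^+ 2 by rewrite sqr_sqrtr// sqnorm_ge0.
    have := enorm_ge0 q.
    rewrite -/(sqnorm y) => q0 qr; nra.
  by rewrite fy0 fq0 subrr mulr0 normr0 mulr_ge0// ltW.
move=> _.
rewrite (_ : (fun t => integral_rV (F t)) = fun=> 0).
  by move=> /(cvg_lim (@Rhausdorff R)) <-; rewrite lim_cst.
apply/funext => h; rewrite /F.
have i1 : integrable_rV (fun y => f (1 *: y + h *: delta_mx 0 j)).
  exact: (integrable_rV_affine _ (oner_neq0 _) fi).
have i2 : integrable_rV (fun y => - f y).
  by under eq_fun do rewrite -mulN1r; exact: integrable_rVZ.
rewrite integral_rVZ; last exact: (integrable_rVD i1 i2).
rewrite (integral_rVD i1 i2) integral_rVN// integral_rV_affine ?oner_neq0//.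
by rewrite normr1 invr1 expr1n mul1r subrr mulr0.
Unshelve. all: by end_near. Qed.
End IntegrationByParts.

(** * Test functions and odd singular kernels *)

Section TestFunctions.
Context {R : realType} {n : nat}.
Implicit Types (f g phi : 'rV[R]_n -> R) (x y v : 'rV[R]_n).

Lemma smooth_differentiable phi x : smooth phi -> differentiable phi x.
Proof. by move=> /(_ [::]). Qed.

Lemma smooth_continuous phi : smooth phi -> continuous phi.
Proof. by move=> sp x; apply: differentiable_continuous; exact: smooth_differentiable. Qed.

Lemma smooth_partial j phi : smooth phi -> smooth (partial j phi).
Proof.
move=> sp s x; have := sp (rcons s j) x.
by rewrite /partials foldr_rcons.
Qed.

Lemma supported_partial (K : set 'rV[R]_n) j phi : compact K -> supported_in K phi ->
  supported_in K (partial j phi).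
Proof.
move=> cK sK; have Kcl : closed K by apply: compact_closed cK; exact: norm_hausdorff.
rewrite /supported_in [X in _ `<=` X]((closure_id K).1 Kcl).
apply: closure_subset => y /= /eqP py.
by apply: contrapT => /(partial_eq0 j sK).
Qed.

Lemma test_function_partial j phi : test_function phi -> test_function (partial j phi).
Proof.
move=> [sp [K cK sK]]; split; first exact: smooth_partial.
by exists K => //; exact: supported_partial.
Qed.

Lemma supported_inM (K : set 'rV[R]_n) f g : supported_in K g ->
  supported_in K (fun y => f y * g y).
Proof.
move=> sK; apply: subset_trans sK; apply: closure_subset => y /=.
by apply: contraNN => /eqP ->; rewrite mulr0.
Qed.

Lemma integrable_test f phi : continuous f -> test_function phi ->
  integrable_rV (fun y => f y * phi y).
Proof.
move=> cf [sp [K cK sK]]; apply: (integrable_continuous cK (supported_inM sK)).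
by move=> y; exact: (continuousM (cf y) (smooth_continuous sp (x := y))).
Qed.

Lemma integration_by_parts_rV f phi j : (forall x, differentiable f x) ->
  continuous (partial j f) -> test_function phi ->
  integral_rV (fun y => partial j f y * phi y) = - integral_rV (fun y => f y * partial j phi y).
Proof.
move=> df cp tp; have [sp [K cK sK]] := tp.
have cf : continuous f by move=> x; exact: differentiable_continuous.
have dphi x : differentiable phi x by exact: smooth_differentiable.
have E : partial j (f * phi) = fun y => f y * partial j phi y + partial j f y * phi y.
  apply/funext => y; rewrite /partial deriveM; first by congr (_ + _); exact: mulrC.
    exact: diff_derivable.
  exact: diff_derivable.
have i1 := integrable_test cf (test_function_partial j tp).
have i2 := integrable_test cp tp.
have := @integral_partial_eq0 R n K (f * phi) j cK (supported_inM sK).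
rewrite E (integral_rVD i1 i2) => H.
apply/eqP; rewrite -addr_eq0 addrC; apply/eqP/H.
  by move=> x; exact: differentiableM.
move=> x; apply: (continuousD (f := fun y => f y * partial j phi y)).
  exact: (continuousM (cf x) (smooth_continuous (smooth_partial j sp) (x := x))).
exact: (continuousM (cp x) (smooth_continuous sp (x := x))).
Qed.

(** Mean value theorem on the segment from -y to y. The factor |y| gained here lowers the
    singularity from |y|^(-n) to the integrable |y|^(1-n). *)
Lemma odd_part_le phi (B : R) y : smooth phi ->
  (forall i x, `|partial i phi x| <= B) ->
  `|phi y - phi (- y)| <= 2 * (n%:R * B) * enorm y.
Proof.
move=> sp pB; have [c Hc] := mean_value_rV (- y) (2 *: y) (fun x => smooth_differentiable x sp).
rewrite [2 *: y]scaler_nat mulr2n addKr in Hc.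
rewrite Hc -mulr2n -scaler_nat.
have -> : 2 * (n%:R * B) * enorm y = n%:R * B * enorm (2 *: y).
  have -> : enorm (2 *: y) = 2 * enorm y.
    have -> : enorm (2 *: y) = Num.sqrt (sqnorm (2 *: y)) by [].
    by rewrite sqnormZ sqrtrM ?sqr_ge0// sqrtr_sqr ger0_norm.
  ring.
by apply: derive_le; [exact: smooth_differentiable|move=> i; exact: pB].
Qed.

(* [y_j / |y|^(n+1)] is odd, so only the odd part of [phi] contributes to the principal value,
   and the integrand becomes absolutely integrable. *)
Definition pv_density j phi y : R :=
  y 0 j * (enorm y)^-1 ^+ n.+1 * ((phi y - phi (- y)) / 2).

(** The bound is linear in the first-order bound [B]: besides dominated convergence it yields the
    continuity estimate, of order one, for the principal value. *)
Lemma pv_density_le j phi (B rho : R) y : smooth phi ->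
  (forall i x, `|partial i phi x| <= B) ->
  (forall x, phi x != 0 -> enorm x <= rho) ->
  `|pv_density j phi y| <= n%:R * B * riesz rho y.
Proof.
move=> sp pB pr; have eN : enorm (- y) = enorm y.
  by rewrite /enorm; congr Num.sqrt; apply: eq_bigr => i _; rewrite mxE sqrrN.
rewrite /pv_density /riesz.
have [yr|ry] := leP (enorm y) rho; last first.
  have p0 z : rho < enorm z -> phi z = 0.
    by move=> rz; apply/eqP; apply: contraTT rz => /pr; rewrite -leNgt.
  by rewrite !p0 ?eN// subrr mul0r mulr0 normr0 mul0r mulr0.
rewrite mul1r expr2 !normrM [`|2^-1|]ger0_norm// [`|_ ^+ _|]ger0_norm ?exprn_ge0 ?invr_ge0 ?enorm_ge0//.
have -> : n%:R * B * (enorm y * enorm y * (enorm y)^-1 ^+ n.+1) =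
   enorm y * (enorm y)^-1 ^+ n.+1 * (2 * (n%:R * B) * enorm y / 2) by field.
apply: ler_pM => //.
- by rewrite mulr_ge0 ?exprn_ge0 ?invr_ge0 ?enorm_ge0.
- by rewrite ler_wpM2r ?exprn_ge0 ?invr_ge0 ?enorm_ge0// coord_le_enorm.
- by rewrite ler_wpM2r// odd_part_le.
Qed.

(** The integral is averaged with its image under y -> -y, which is legitimate because the
    regularised integrand is absolutely integrable. *)
Lemma odd_symmetrization j (k : 'rV[R]_n -> R) phi : (forall y, k (- y) = k y) ->
  integrable_rV (fun y => y 0 j * k y * phi y) ->
  integral_rV (fun y => y 0 j * k y * phi y) =
  integral_rV (fun y => y 0 j * k y * ((phi y - phi (- y)) / 2)).
Proof.
move=> ke hi; have N1 : - 1 != 0 :> R by rewrite oppr_eq0 oner_eq0.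
have hN := integrable_rV_affine 0 N1 hi.
have -> : (fun y : 'rV[R]_n => y 0 j * k y * ((phi y - phi (- y)) / 2)) =
  fun y => 2^-1 * (y 0 j * k y * phi y + (-1 *: y + 0) 0 j * k (-1 *: y + 0) * phi (-1 *: y + 0)).
  by apply/funext => y; rewrite addr0 scaleN1r ke mxE; field.
rewrite integral_rVZ; last exact: integrable_rVD hi hN.
rewrite (integral_rVD hi hN) (integral_rV_affine 0 N1 hi) normrN1 invr1 expr1n mul1r.
by field.
Qed.

(** The regularisation [k t] is left abstract because two of them are needed, the sharp truncation
    of Pv and the slice at height t; the limit does not depend on the choice. *)
Lemma odd_kernel_cvg j (k : R -> 'rV[R]_n -> R) phi (B rho : R) :
  (forall t, 0 < t <= 1 -> measurable_rV (k t)) ->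
  (forall t y, k t (- y) = k t y) ->
  (forall t y, 0 < t <= 1 -> 0 < enorm y -> 0 <= k t y <= (enorm y)^-1 ^+ n.+1) ->
  (forall y, 0 < enorm y -> k t y @[t --> 0^'+] --> (enorm y)^-1 ^+ n.+1) ->
  (forall t, 0 < t <= 1 -> integrable_rV (fun y => y 0 j * k t y * phi y)) ->
  smooth phi -> (forall i x, `|partial i phi x| <= B) -> 0 < rho ->
  (forall x, phi x != 0 -> enorm x <= rho) ->
  integrable_rV (pv_density j phi) /\
  integral_rV (fun y => y 0 j * k t y * phi y) @[t --> 0^'+] --> integral_rV (pv_density j phi).
Proof.
move=> mk ke kle kcvg ki sp pB rho0 pr.
have mphi : measurable_rV phi by apply: continuous_measurable_rV; exact: smooth_continuous.
have mphiN : measurable_rV (fun y => phi (- y)).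
  have := measurable_fun_rV_affine (-1) 0 mphi.
  by under eq_fun do rewrite addr0 scaleN1r.
(* At the origin the limit kernel is singular, but the factor y_j vanishes there, so nothing has to
   be known about [k t]. *)
have y0 y : ~~ (0 < enorm y) -> y 0 j = 0.
  rewrite -leNgt => y0; apply/eqP; rewrite -normr_le0.
  exact: (le_trans (coord_le_enorm y j)).
have [] := @dominated_cvg_at_right R n
  (fun t y => y 0 j * k t y * ((phi y - phi (- y)) / 2)) (pv_density j phi)
  (fun y => n%:R * B * riesz rho y).
- move=> t t01; apply: measurable_rVM.
    by apply: measurable_rVM; [exact: measurable_rV_coord|exact: mk].
  by apply: measurable_rVM; [exact: measurable_rVB|exact: measurable_rV_cst].
- move=> y; apply: cvgM; last exact: cvg_cst.
  have [yp|/y0 ->] := boolP (0 < enorm y).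
    by apply: cvgM; [exact: cvg_cst|exact: kcvg].
  under eq_fun do rewrite mul0r.
  by rewrite mul0r; exact: cvg_cst.
- exact/integrable_rVZ/integrable_riesz.
- move=> t y t01; apply: le_trans (pv_density_le j y sp pB pr).
  rewrite /pv_density !normrM ler_wpM2r//.
  have [yp|/y0 ->] := boolP (0 < enorm y); last by rewrite normr0 !mul0r.
  rewrite ler_wpM2l//; have /andP[k0 k1] := kle t y t01 yp.
  by rewrite !ger0_norm// (le_trans k0).
move=> pi cv; split => //; apply: cvg_trans cv; apply: near_eq_cvg; near=> t.
apply/esym/odd_symmetrization => //; apply: ki; apply/andP; split.
  by near: t; exact: nbhs_right_gt.
by near: t; exact: nbhs_right_le.
Unshelve. all: by end_near. Qed.

End TestFunctions.

(** * Monogenicity of the potentials *)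

Section KernelExpressions.
Context {R : realType} {n : nat}.
Implicit Types (x : 'rV[R]_n) (i j : 'I_n).

(* Off the origin all functions involved are polynomials in the coordinates and [1/|x|]. Working
   with a syntax for these and a symbolic derivative makes the symmetry of second derivatives an
   algebraic identity ([kderC]). *)
Inductive kexpr : Type :=
| KCst of R
| KCoord of 'I_n
| KInv
| KAdd of kexpr & kexpr
| KMul of kexpr & kexpr.
Implicit Types e : kexpr.

Fixpoint keval e x : R :=
  match e with
  | KCst c => c
  | KCoord i => x 0 i
  | KInv => (enorm x)^-1
  | KAdd e1 e2 => keval e1 x + keval e2 x
  | KMul e1 e2 => keval e1 x * keval e2 x
  end.

Fixpoint kpow e k : kexpr := if k is k'.+1 then KMul e (kpow e k') else KCst 1.

Fixpoint kder i e : kexpr :=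
  match e with
  | KCst _ => KCst 0
  | KCoord j => KCst (i == j)%:R
  | KInv => KMul (KCst (-1)) (KMul (KCoord i) (kpow KInv 3))
  | KAdd e1 e2 => KAdd (kder i e1) (kder i e2)
  | KMul e1 e2 => KAdd (KMul e1 (kder i e2)) (KMul e2 (kder i e1))
  end.

Definition ksum (s : seq kexpr) : kexpr := foldr KAdd (KCst 0) s.

Lemma keval_pow e k x : keval (kpow e k) x = keval e x ^+ k.
Proof. by elim: k => //= k ->; rewrite exprS. Qed.

Lemma keval_sum (s : seq kexpr) x : keval (ksum s) x = \sum_(e <- s) keval e x.
Proof. by elim: s => [|e s IH]; rewrite ?big_nil ?big_cons //= IH. Qed.

Lemma kder_sum i (s : seq kexpr) : kder i (ksum s) = ksum [seq kder i e | e <- s].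
Proof. by elim: s => //= e s ->. Qed.

Lemma enorm_gt0 x : x != 0 -> 0 < enorm x.
Proof.
move=> /rV0Pn [i xi]; apply: lt_le_trans (coord_le_enorm x i).
by rewrite normr_gt0.
Qed.

Lemma sqr_enorm x : enorm x ^+ 2 = sqnorm x.
Proof. by rewrite sqr_sqrtr// sqnorm_ge0. Qed.

Lemma enorm_inv_derive x : x != 0 ->
  differentiable (fun y : 'rV[R]_n => (enorm y)^-1) x /\
  forall i, partial i (fun y => (enorm y)^-1) x = - (x 0 i * (enorm x)^-1 ^+ 3).
Proof.
move=> x0; have ex := enorm_gt0 x0.
have qx : 0 < sqnorm x by rewrite -sqr_enorm exprn_gt0.
pose g (u : R) : R := (Num.sqrt u)^-1.
have [d1 d2] : is_derive (sqnorm x) 1 g (- (Num.sqrt (sqnorm x)) ^- 2 *: (2 * Num.sqrt (sqnorm x))^-1).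
  by apply: is_deriveV; [rewrite gt_eqF|exact: is_derive1_sqrt].
have dg : differentiable g (sqnorm x) by exact/derivable1_diffP.
have dq := differentiable_sqnorm x.
have E : (fun y : 'rV[R]_n => (enorm y)^-1) = g \o @sqnorm R n by [].
rewrite E; split=> [|i]; first exact: differentiable_comp.
rewrite /partial deriveE; last exact: differentiable_comp.
have Hd : 'd (@sqnorm R n) x (delta_mx 0 i) = 2 * x 0 i.
  by rewrite -partial_sqnorm /partial deriveE.
rewrite diff_comp//= Hd.
rewrite diff1E// derive1E d2 -/(enorm x) /=.
by rewrite -[_ *: _]/(_ * _) -[_ *: _]/(_ * _); field; rewrite gt_eqF.
Qed.

Lemma kder_correct e x : x != 0 -> differentiable (keval e) x /\
  forall i, partial i (keval e) x = keval (kder i e) x.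
Proof.
move=> x0; elim: e => [c|j||e1 [d1 p1] e2 [d2 p2]|e1 [d1 p1] e2 [d2 p2]] /=.
- by split=> [|i]; [exact: differentiable_cst|rewrite /partial derive_cst].
- split=> [|i]; first exact: differentiable_coord.
  have [_ H] := is_derive_coord x (delta_mx 0 i) j.
  by rewrite /partial H mxE eqxx eq_sym.
- split=> [|i].
    by have [] := enorm_inv_derive x0.
  by have [_ ->] := enorm_inv_derive x0; ring.
- split=> [|i]; first exact: differentiableD.
  by rewrite -p1 -p2 /partial -deriveD//; exact: diff_derivable.
- split=> [|i]; first exact: differentiableM.
  by rewrite -p1 -p2 /partial -deriveM//; exact: diff_derivable.
Qed.

Lemma keval_continuous e x : x != 0 -> {for x, continuous (keval e)}.
Proof. by move=> x0; apply: differentiable_continuous; have [] := kder_correct e x0. Qed.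

Lemma kderC i j e x : keval (kder i (kder j e)) x = keval (kder j (kder i e)) x.
Proof.
elim: e => [c|k||e1 H1 e2 H2|e1 H1 e2 H2] //=.
- by rewrite eq_sym; ring.
- by rewrite H1 H2.
- by rewrite H1 H2; ring.
Qed.

Lemma near_punctured x : x != 0 -> \forall y \near x, y != 0.
Proof.
move=> x0; have : nbhs x [set y : 'rV[R]_n | 0 < enorm y].
  apply: (@enorm_continuous R n x [set r | 0 < r]).
  by apply: open_nbhs_nbhs; split; [exact: open_gt|exact: enorm_gt0].
apply: filterS => y /=; apply: contraTneq => ->.
by rewrite /enorm big1 ?sqrtr0 ?ltxx// => i _; rewrite mxE expr0n.
Qed.

(** The symbolic derivative is the true one off the origin, and that set is open; hence it depends
    on the function only and not on the expression. *)
Lemma kder_ext e1 e2 i : (forall x, x != 0 -> keval e1 x = keval e2 x) ->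
  forall x, x != 0 -> keval (kder i e1) x = keval (kder i e2) x.
Proof.
move=> E x x0; have [_ <-] := kder_correct e1 x0; have [_ <-] := kder_correct e2 x0.
apply: near_eq_derive; have := near_punctured x0; apply: filterS => y; exact: E.
Qed.

(* The Cauchy kernel is, up to [1/sigma_(m+1)], the sum of [x_i / |x|^n] times [para_conj i],
   with [n = m+1]. *)
Definition cauchy_component i : kexpr := KMul (KCoord i) (kpow KInv n).

Lemma kder_pow i k x : keval (kder i (kpow KInv k)) x =
  - (k%:R * x 0 i * (enorm x)^-1 ^+ k.+2).
Proof.
elim: k => [|k IH]; first by rewrite !mul0r oppr0.
by rewrite /= IH keval_pow /= -natr1 !exprS; ring.
Qed.

Lemma kder_component i j x : keval (kder j (cauchy_component i)) x =
  (j == i)%:R * (enorm x)^-1 ^+ n - n%:R * x 0 i * x 0 j * (enorm x)^-1 ^+ n.+2.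
Proof. by rewrite /= kder_pow keval_pow /=; ring. Qed.

End KernelExpressions.

(** * Curl and divergence of the component fields *)

Section CauchyComponents.
Context {R : realType} {m : nat}.
Implicit Types (x : 'rV[R]_m.+1) (i j : 'I_m.+1).

Definition normal_iter k i : @kexpr R m.+1 := iter k (kder ord0) (cauchy_component i).

Lemma normal_iter_curl k i j x : x != 0 ->
  keval (kder j (normal_iter k i)) x = keval (kder i (normal_iter k j)) x.
Proof.
elim: k x => [|k IH] x x0; first by rewrite !kder_component eq_sym; ring.
rewrite /= kderC [RHS]kderC; exact: kder_ext.
Qed.

(** For k = 0 the m+1 diagonal terms |x|^(-m-1) cancel against (m+1) |x|^2 |x|^(-m-3). Then d/dx_0
    commutes with the divergence and differentiates a function vanishing off the origin. *)
Lemma normal_iter_div k x : x != 0 -> \sum_i keval (kder i (normal_iter k i)) x = 0.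
Proof.
have E l y : \sum_i keval (kder i (normal_iter l i)) y =
    keval (ksum [seq kder i (normal_iter l i) | i : 'I_m.+1]) y.
  by rewrite keval_sum big_map big_enum.
elim: k x => [|k IH] x x0.
  under eq_bigr do rewrite kder_component eqxx mul1r.
  rewrite sumrB sumr_const card_ord -mulr_natl.
  under eq_bigr do rewrite -[_ * x 0 _ * x 0 _]mulrA -expr2 -mulrA [_ ^+ 2 * _]mulrC.
  rewrite -mulr_sumr -mulr_sumr -/(sqnorm x) -sqr_enorm.
  have ex := enorm_gt0 x0.
  have -> : (enorm x)^-1 ^+ m.+3 * enorm x ^+ 2 = (enorm x)^-1 ^+ m.+1.
    by rewrite -[m.+3]addn2 exprD -mulrA -exprMn mulVf ?expr1n ?mulr1// gt_eqF.
  by rewrite mulr1 mulr_natl subrr.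
transitivity (keval (kder ord0 (ksum [seq kder i (normal_iter k i) | i : 'I_m.+1])) x).
  rewrite kder_sum keval_sum -map_comp big_map big_enum.
  by apply: eq_bigr => i _; exact: kderC.
rewrite (@kder_ext _ _ _ (KCst 0))// => y y0; by rewrite -E IH.
Qed.

End CauchyComponents.

Lemma near_eq_differentiable (R : numFieldType) (V W : normedModType R)
    (f g : V -> W) (x : V) :
  (\near x, f x = g x) -> differentiable g x -> differentiable f x.
Proof.
move=> fg dg; have fgx : f x = g x by exact: nbhs_singleton fg.
have fl : f \o shift x = cst (f x) + 'd g x +o_ 0 id.
  apply/eqaddoP => _/posnumP[e].
  have /eqaddoP/(_ e%:num [gt0 of e%:num]) := diff_locally dg.
  have : \forall h \near (0 : V), f (h + x) = g (h + x).
    by move: fg; rewrite [\forall x \near _, _ = _](near_shift 0) subr0.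
  by apply: filterS2 => h fgh; rewrite !fctE /= fgh fgx.
have fd := diff_unique (diff_continuous dg) fl.
by apply/diff_locallyP; rewrite fd; split => //; exact: diff_continuous.
Qed.

(** * Cauchy-Riemann operators in the Clifford algebra *)

Section Monogenic.
Context {R : realType} {m : nat}.
Local Notation Cl := (clifford R m.+1).
Local Notation e0b := (e0bar R m).
Local Notation e0' := (e0 R m).
Implicit Types (x : 'rV[R]_m.+1) (i j k : 'I_m.+1) (a c : Cl).

(* [para i] is [1] for [i = 0] and [e0bar e_j] for [i = lift ord0 j], so that [Dop] is half the sum
   of [para i * d/dx_i]; [para_conj i] is [1], resp. [- e0bar e_j]. *)
Definition para i : Cl := e0b * gen R i.
Definition para_conj i : Cl := gen R i * e0b.

Lemma e0_sqr : e0' * e0' = -1.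
Proof.
have := gen_anticomm R (ord0 : 'I_m.+1) ord0; rewrite eqxx mulr1 -/(e0 R m) => H.
have two : (2 : R) != 0 by rewrite pnatr_eq0.
apply: (scalerI two); rewrite scaler_nat mulr2n H.
by rewrite scaleNr scalerN.
Qed.

Lemma e0bar_sqr : e0b * e0b = -1.
Proof. by rewrite mulrNN e0_sqr. Qed.

Lemma e0bar_e0 : e0b * e0' = 1.
Proof. by rewrite mulNr e0_sqr opprK. Qed.

Lemma e0_e0bar : e0' * e0b = 1.
Proof. by rewrite mulrN e0_sqr opprK. Qed.

Lemma para0 : para ord0 = 1.
Proof. exact: e0bar_e0. Qed.

Lemma para_conj0 : para_conj ord0 = 1.
Proof. exact: e0_e0bar. Qed.

Lemma e0_anticomm (j : 'I_m) : e0' * e_ R j = - (e_ R j * e0').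
Proof.
apply/eqP; rewrite -subr_eq0 opprK; apply/eqP.
have := gen_anticomm R (ord0 : 'I_m.+1) (lift ord0 j).
by rewrite (negPf (neq_lift _ _)) mulr0 scale0r.
Qed.

Lemma e0bar_anticomm (j : 'I_m) : e0b * e_ R j = - (e_ R j * e0b).
Proof. by rewrite mulNr e0_anticomm mulrN !opprK. Qed.

Lemma para_conj_lift (j : 'I_m) : para_conj (lift ord0 j) = - (e0b * e_ R j).
Proof. by rewrite e0bar_anticomm opprK. Qed.

(** This is the Clifford relation placed between two factors e0bar, whose square is -1. *)
Lemma para_para_conj k i :
  para k * para_conj i + para i * para_conj k = (2 * (k == i)%:R) *: 1.
Proof.
rewrite /para /para_conj !mulrA -mulrDl -!(mulrA e0b) -mulrDr gen_anticomm.
by rewrite -scalerAr mulr1 -scalerAl e0bar_sqr mulNr scaleNr scalerN opprK.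
Qed.

Lemma para_conj_para k i :
  para_conj i * para k + para_conj k * para i = (2 * (k == i)%:R) *: 1.
Proof.
rewrite /para /para_conj !mulrA -!(mulrA _ e0b e0b) e0bar_sqr !mulrN1 !mulNr -opprD.
by rewrite gen_anticomm mulNr scaleNr opprK eq_sym.
Qed.

(** A symmetric [M] sees only the symmetric part of [B], which is diagonal and scalar, so the sum is
    the trace of [M]. With [M] the Jacobian of a field, vanishing curl gives the symmetry and
    vanishing divergence the trace. *)
Lemma traceless_sum_eq0 (M : 'I_m.+1 -> 'I_m.+1 -> R) (B : 'I_m.+1 -> 'I_m.+1 -> Cl) :
  (forall k i, M k i = M i k) -> \sum_i M i i = 0 ->
  (forall k i, B k i + B i k = (2 * (k == i)%:R) *: 1) ->
  \sum_k \sum_i M k i *: B k i = 0.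
Proof.
move=> Ms Mt HB; have two : (2 : R) != 0 by rewrite pnatr_eq0.
(* The sum is doubled and one copy transposed, so that [B k i + B i k] appears. *)
apply: (scalerI two); rewrite scaler0 scaler_nat mulr2n.
rewrite {2}exchange_big -big_split /=.
under eq_bigr => k _.
  rewrite -big_split /= (eq_bigr (fun i => (M k i * (2 * (k == i)%:R)) *: 1)); last first.
    by move=> i _; rewrite (Ms i k) -scalerDr HB scalerA.
  rewrite (bigD1 k)//= eqxx big1 ?addr0 => [|i /negPf ik]; last first.
    by rewrite eq_sym ik !mulr0 scale0r.
  over.
rewrite -scaler_suml; under eq_bigr do rewrite mulr1.
by rewrite -mulr_suml Mt mul0r scale0r.
Qed.

Lemma coord_sum (I : finType) (f : I -> R) (c : I -> Cl) A :
  cl_coord (\sum_l f l *: c l) A = \sum_l f l * cl_coord (c l) A.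
Proof. by rewrite /cl_coord sum_ffunE; apply: eq_bigr => l _; rewrite ffunE. Qed.

Lemma clP a c : (forall A, cl_coord a A = cl_coord c A) -> a = c.
Proof. by move=> H; apply/ffunP. Qed.

Section expansion.
Variables (F : 'rV[R]_m.+1 -> Cl) (I : finType) (f : I -> @kexpr R m.+1) (c : I -> Cl).
Hypothesis FE : forall x, x != 0 -> F x = \sum_l keval (f l) x *: c l.

Let comb A : @kexpr R m.+1 := ksum [seq KMul (KCst (cl_coord (c l) A)) (f l) | l : I].

Let coordE A x : x != 0 -> cl_coord (F x) A = keval (comb A) x.
Proof.
move=> x0; rewrite FE// coord_sum keval_sum big_map big_enum.
by apply: eq_bigr => l _ /=; rewrite mulrC.
Qed.

Let partial_coord A i x : x != 0 ->
  partial i (fun z => cl_coord (F z) A) x = keval (kder i (comb A)) x.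
Proof.
move=> x0; have [_ <-] := kder_correct (comb A) x0; apply: near_eq_derive.
by have := near_punctured x0; apply: filterS => y; exact: coordE.
Qed.

Lemma clpartial_kernel i x : x != 0 ->
  clpartial i F x = \sum_l keval (kder i (f l)) x *: c l.
Proof.
move=> x0; apply: clP => A; rewrite coord_sum {1}/cl_coord ffunE partial_coord//.
rewrite kder_sum keval_sum -map_comp big_map big_enum.
by apply: eq_bigr => l _ /=; rewrite mulr0 addr0 mulrC.
Qed.

Lemma C1_on_kernel (U : set 'rV[R]_m.+1) : (forall x, U x -> x != 0) -> C1_on U F.
Proof.
move=> U0 A x /U0 x0; split.
  have [d _] := kder_correct (comb A) x0.
  have near_eq : \forall y \near x, cl_coord (F y) A = keval (comb A) y.
    by have := near_punctured x0; apply: filterS => y y0; rewrite coordE.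
  exact: near_eq_differentiable near_eq d.
move=> i.
have H : keval (kder i (comb A)) y @[y --> x] --> partial i (fun z => cl_coord (F z) A) x.
  by rewrite partial_coord//; exact: keval_continuous.
apply: cvg_trans H; apply: (near_eq_cvg (F := nbhs x)).
by have := near_punctured x0; apply: filterS => y y0; rewrite partial_coord.
Qed.

End expansion.

Lemma DopE F x : Dop F x = 2^-1 *: \sum_i para i * clpartial i F x.
Proof.
rewrite big_ord_recl para0 mul1r; congr (_ *: (_ + _)).
by rewrite mulr_sumr; apply: eq_bigr => j _; rewrite mulrA.
Qed.

Lemma Dop_rightE F x : Dop_right F x = 2^-1 *: \sum_i clpartial i F x * para i.
Proof. by rewrite big_ord_recl para0 mulr1. Qed.

Lemma DbarE F x : Dbar F x = clpartial ord0 F x - Dop F x.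
Proof.
rewrite /Dbar /Dop; set a := clpartial _ _ _; set c := e0b * _.
apply/eqP; rewrite eq_sym subr_eq -scalerDr addrACA addNr addr0.
by rewrite -mulr2n -[a *+ 2]scaler_nat scalerA mulVf ?scale1r ?pnatr_eq0.
Qed.

Section components.
Variables (k : nat) (a : Cl).

(** The constant [a] stands on the side opposite to the operator, so it factors out; the mirrored
    statement below keeps it on the left. *)
Lemma Dop_component (F : 'rV[R]_m.+1 -> Cl) :
  (forall x, x != 0 -> F x = \sum_i keval (normal_iter k i) x *: (para_conj i * a)) ->
  forall x, x != 0 -> Dop F x = 0.
Proof.
move=> FE x x0; rewrite DopE.
under eq_bigr => j _.
  rewrite (clpartial_kernel FE)// mulr_sumr.
  under eq_bigr do rewrite -scalerAr mulrA scalerAl.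
  rewrite -mulr_suml; over.
rewrite -mulr_suml traceless_sum_eq0 ?mul0r ?scaler0//.
- by move=> j i; exact: normal_iter_curl.
- exact: normal_iter_div.
- exact: para_para_conj.
Qed.

Lemma Dop_right_component (F : 'rV[R]_m.+1 -> Cl) :
  (forall x, x != 0 -> F x = \sum_i keval (normal_iter k i) x *: (a * para_conj i)) ->
  forall x, x != 0 -> Dop_right F x = 0.
Proof.
move=> FE x x0; rewrite Dop_rightE.
under eq_bigr => j _.
  rewrite (clpartial_kernel FE)// mulr_suml.
  under eq_bigr do rewrite -scalerAl -mulrA scalerAr.
  rewrite -mulr_sumr; over.
rewrite -mulr_sumr traceless_sum_eq0 ?mulr0 ?scaler0//.
- by move=> j i; exact: normal_iter_curl.
- exact: normal_iter_div.
- by move=> j i; exact: para_conj_para.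
Qed.

Lemma left_monogenic_component U (F : 'rV[R]_m.+1 -> Cl) : (forall x, U x -> x != 0) ->
  (forall x, x != 0 -> F x = \sum_i keval (normal_iter k i) x *: (para_conj i * a)) ->
  left_monogenic U F.
Proof.
move=> U0 FE; split; first exact: (C1_on_kernel FE).
by move=> x /U0; exact: Dop_component.
Qed.

Lemma right_monogenic_component U (F : 'rV[R]_m.+1 -> Cl) : (forall x, U x -> x != 0) ->
  (forall x, x != 0 -> F x = \sum_i keval (normal_iter k i) x *: (a * para_conj i)) ->
  right_monogenic U F.
Proof.
move=> U0 FE; split; first exact: (C1_on_kernel FE).
by move=> x /U0; exact: Dop_right_component.
Qed.

End components.

Local Notation sigma := (sphere_area R m.+1).

Lemma CnegE (k : nat) x : x != 0 ->
  Cneg k.+1 x = \sum_i keval (normal_iter k i) x *: (para_conj i * sigma^-1%:A).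
Proof.
elim: k x => [|k IH] x x0.
  rewrite /Cneg /= /cauchy_kernel big_ord_recl para_conj0 mul1r /= keval_pow /=.
  rewrite scalerBr scalerBr !scalerA; congr (_ + _).
    by rewrite -exprS exprVn /normal_part; congr (_ *: _); ring.
  rewrite /vec mulr_sumr -scalerN -sumrN scaler_sumr; apply: eq_bigr => j _ /=.
  rewrite mxE para_conj_lift -[e0b * (_ *: _)]scalerAr -[_ * _%:A]scalerAr mulr1 -exprS exprVn !scalerN !scalerA.
  by congr (- (_ *: _)); ring.
(* [Dbar] is d/dx_0 minus [Dop], and [Dop] annihilates the previous potential. *)
rewrite [Cneg k.+2 x]DbarE (Dop_component IH)// subr0.
by rewrite (clpartial_kernel IH).
Qed.

(** A normal derivative cannot be integrated by parts over a slice, whereas these tangential ones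
    can. *)
Lemma Cneg_next (k : nat) x : x != 0 ->
  Cneg k.+2 x = - \sum_(j < m) e0b * e_ R j * clpartial (lift ord0 j) (Cneg k.+1) x.
Proof.
move=> x0; rewrite [Cneg k.+2 x]DbarE (Dop_component (@CnegE k))// subr0.
have := Dop_component (@CnegE k) x0; rewrite DopE => /eqP.
rewrite scaler_eq0 invr_eq0 pnatr_eq0 /= big_ord_recl para0 mul1r addr_eq0 => /eqP ->.
by [].
Qed.

End Monogenic.

(** * Boundary values *)

Section Slices.
Context {R : realType} {m : nat}.
Local Notation Cl := (clifford R m.+1).
Local Notation e0b := (e0bar R m).
Local Notation sigma := (sphere_area R m.+1).
Implicit Types (y : 'rV[R]_m) (t : R) (phi : 'rV[R]_m -> R) (a : Cl).

Lemma point_ord0 t y : Defs.point t y 0 ord0 = t.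
Proof.
have -> : (ord0 : 'I_m.+1) = lshift m (ord0 : 'I_1) by exact: val_inj.
transitivity ((t%:M : 'M[R]_1) 0 0); first exact: row_mxEl.
by rewrite mxE eqxx mulr1n.
Qed.

Lemma point_lift t y (j : 'I_m) : Defs.point t y 0 (lift ord0 j) = y 0 j.
Proof.
have -> : lift (ord0 : 'I_m.+1) j = rshift 1 j by exact: val_inj.
exact: row_mxEr.
Qed.

Lemma point_neq0 t y : t != 0 -> Defs.point t y != 0.
Proof. by apply: contraNneq => H; rewrite -(point_ord0 t y) H mxE. Qed.

Lemma upper_half_neq0 (x : 'rV[R]_m.+1) : upper_half x -> x != 0.
Proof. by rewrite /upper_half /normal_part /=; apply: contraTneq => ->; rewrite mxE ltxx. Qed.

Lemma lower_half_neq0 (x : 'rV[R]_m.+1) : lower_half x -> x != 0.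
Proof. by rewrite /lower_half /normal_part /=; apply: contraTneq => ->; rewrite mxE ltxx. Qed.

Lemma sqnorm_point t y : sqnorm (Defs.point t y) = t ^+ 2 + sqnorm y.
Proof.
rewrite /sqnorm big_ord_recl point_ord0; congr (_ + _).
by apply: eq_bigr => j _; rewrite point_lift.
Qed.

Lemma enorm_point_inv t y : (enorm (Defs.point t y))^-1 = radial_inv t y.
Proof.
rewrite (_ : enorm (Defs.point t y) = Num.sqrt (sqnorm (Defs.point t y)))//.
by rewrite sqnorm_point.
Qed.

Lemma differentiable_point t y : differentiable (Defs.point t) y.
Proof.
have l0 : linear (Defs.point 0 : 'rV[R]_m -> 'rV[R]_m.+1).
  move=> k u v; apply/rowP => i; rewrite !mxE.
  by case: splitP => j _; rewrite !mxE ?mul0rn ?mulr0 ?addr0.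
pose p : {linear 'rV[R]_m -> 'rV[R]_m.+1} := HB.pack (Defs.point 0) (GRing.isLinear.Build _ _ _ _ _ l0).
have cp : continuous p.
  move=> u A /nbhs_ballP[e /= e0 eA].
  apply/nbhs_ballP; exists e => //= v [_ uv]; apply: eA; split => // i j.
  rewrite ord1; case: (unliftP ord0 j) => [k|] ->.
    by rewrite /= !point_lift; exact: uv.
  by rewrite /= !point_ord0; exact: ballxx.
rewrite (_ : Defs.point t = cst (Defs.point t 0) + p).
  by apply: differentiableD => //; exact: linear_differentiable.
apply/funext => u; apply/rowP => j; rewrite fctE [in RHS]mxE /=.
case: (unliftP ord0 j) => [k|] ->; first by rewrite !point_lift mxE add0r.
by rewrite !point_ord0 addr0.
Qed.

Lemma partial_slice (f : 'rV[R]_m.+1 -> R) t j y :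
  partial j (fun y => f (Defs.point t y)) y = partial (lift ord0 j) f (Defs.point t y).
Proof.
rewrite /partial /derive.
have E h : Defs.point t (h *: delta_mx 0 j + y) = h *: delta_mx 0 (lift ord0 j) + Defs.point t y.
  apply/rowP => i; rewrite [in RHS]mxE.
  case: (unliftP ord0 i) => [k|] ->.
    by rewrite !point_lift !mxE eqxx /= (inj_eq lift_inj).
  by rewrite !point_ord0 !mxE eqxx /= mulr0 add0r.
by congr (lim (_ @ 0^')); apply/funext => h /=; rewrite E.
Qed.

Lemma slice_differentiable (e : @kexpr R m.+1) t y : t != 0 ->
  differentiable (fun y => keval e (Defs.point t y)) y.
Proof.
move=> t0; apply: (@differentiable_comp _ _ _ _ (Defs.point t) (keval e)).
  exact: differentiable_point.
by have [] := kder_correct e (point_neq0 y t0).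
Qed.

Lemma slice_continuous (e : @kexpr R m.+1) t : t != 0 ->
  continuous (fun y => keval e (Defs.point t y)).
Proof. by move=> t0 y; apply: differentiable_continuous; exact: slice_differentiable. Qed.

Lemma partial_slice_kernel (e : @kexpr R m.+1) t j : t != 0 ->
  partial j (fun y => keval e (Defs.point t y)) = fun y => keval (kder (lift ord0 j) e) (Defs.point t y).
Proof.
move=> t0; apply/funext => y; rewrite partial_slice.
by have [_ ->] := kder_correct e (point_neq0 y t0).
Qed.

Lemma slice_parts (e : @kexpr R m.+1) t j phi : t != 0 -> test_function phi ->
  integral_rV (fun y => keval (kder (lift ord0 j) e) (Defs.point t y) * phi y) =
  - integral_rV (fun y => keval e (Defs.point t y) * partial j phi y).
Proof.
move=> t0 tp; rewrite -integration_by_parts_rV//.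
- by rewrite partial_slice_kernel.
- by move=> y; exact: slice_differentiable.
- by rewrite partial_slice_kernel//; exact: slice_continuous.
Qed.

Lemma regular_sum (I : finType) (f : I -> 'rV[R]_m -> R) (c : I -> Cl) (F : 'rV[R]_m -> Cl) phi :
  (forall y, F y = \sum_l f l y *: c l) ->
  (forall l, integrable_rV (fun y => f l y * phi y)) ->
  regular F phi = \sum_l integral_rV (fun y => f l y * phi y) *: c l.
Proof.
move=> FE fi; apply: clP => A; rewrite coord_sum {1}/cl_coord ffunE.
rewrite (_ : (fun y => _) = fun y => \sum_l cl_coord (c l) A * (f l y * phi y)); last first.
  apply/funext => y; rewrite FE coord_sum mulr_suml; apply: eq_bigr => l _; ring.
rewrite integral_rV_sum => [|l]; last exact: integrable_rVZ.
by apply: eq_bigr => l _; rewrite integral_rVZ// mulrC.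
Qed.

Lemma integrable_slice (e : @kexpr R m.+1) t phi : t != 0 -> test_function phi ->
  integrable_rV (fun y => keval e (Defs.point t y) * phi y).
Proof. by move=> t0 tp; apply: integrable_test => //; exact: slice_continuous. Qed.

Lemma regular_CnegM k a t phi : t != 0 -> test_function phi ->
  regular (fun y => a * Cneg k.+1 (Defs.point t y)) phi =
  \sum_i integral_rV (fun y => keval (normal_iter k i) (Defs.point t y) * phi y) *:
    (a * (para_conj i * sigma^-1%:A)).
Proof.
move=> t0 tp; apply: (regular_sum (f := fun i y => keval (normal_iter k i) (Defs.point t y))).
  move=> y; rewrite CnegE ?point_neq0// mulr_sumr.
  by apply: eq_bigr => i _; rewrite -scalerAr.
by move=> i; exact: integrable_slice.
Qed.

Lemma regular_Cneg k t phi : t != 0 -> test_function phi ->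
  regular (fun y => Cneg k.+1 (Defs.point t y)) phi =
  \sum_i integral_rV (fun y => keval (normal_iter k i) (Defs.point t y) * phi y) *:
    (para_conj i * sigma^-1%:A).
Proof.
move=> t0 tp; have := regular_CnegM k 1 t0 tp.
under [in LHS]eq_fun do rewrite mul1r.
by under [in RHS]eq_bigr do rewrite mul1r.
Qed.

Lemma regular_Cneg_lmul k a t phi : t != 0 -> test_function phi ->
  regular (fun y => a * Cneg k.+1 (Defs.point t y)) phi =
  a * regular (fun y => Cneg k.+1 (Defs.point t y)) phi.
Proof.
move=> t0 tp; rewrite regular_CnegM// regular_Cneg// mulr_sumr.
by apply: eq_bigr => i _; rewrite -[RHS]scalerAr.
Qed.

(** The sign from integration by parts cancels the one in [Cneg_next]. *)
Lemma regular_Cneg_next k t phi : t != 0 -> test_function phi ->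
  regular (fun y => Cneg k.+2 (Defs.point t y)) phi =
  \sum_j e0b * e_ R j * regular (fun y => Cneg k.+1 (Defs.point t y)) (partial j phi).
Proof.
move=> t0 tp.
rewrite (regular_sum (I := ('I_m * 'I_m.+1)%type)
  (f := fun p y => keval (kder (lift ord0 p.1) (normal_iter k p.2)) (Defs.point t y))
  (c := fun p => - (e0b * e_ R p.1 * (para_conj p.2 * sigma^-1%:A)))).
- transitivity (\sum_j \sum_i
    integral_rV (fun y => keval (kder (lift ord0 j) (normal_iter k i)) (Defs.point t y) * phi y) *:
    - (e0b * e_ R j * (para_conj i * sigma^-1%:A))).
    by rewrite pair_big.
  apply: eq_bigr => j _; rewrite regular_Cneg ?mulr_sumr//; last exact: test_function_partial.
  apply: eq_bigr => i _; rewrite slice_parts// scalerN -scaleNr opprK.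
  by rewrite -[RHS]scalerAr.
- move=> y; rewrite Cneg_next ?point_neq0// -sumrN.
  rewrite -(pair_big xpredT xpredT (fun j i => keval (kder (lift ord0 j) (normal_iter k i)) (Defs.point t y) *:
    - (e0b * e_ R j * (para_conj i * sigma^-1%:A)))) /=.
  apply: eq_bigr => j _.
  rewrite (clpartial_kernel (@CnegE _ _ k)) ?point_neq0// mulr_sumr -sumrN.
  by apply: eq_bigr => i _; rewrite scalerN -scalerAr.
- by move=> p; exact: integrable_slice.
Qed.

End Slices.

(** * Boundary values of the Cauchy kernel *)

Section BoundaryValues.
Context {R : realType} {m : nat}.
Local Notation Cl := (clifford R m.+1).
Local Notation e0b := (e0bar R m).
Local Notation sigma := (sphere_area R m.+1).
Implicit Types (y : 'rV[R]_m) (t : R) (phi psi : 'rV[R]_m -> R) (a c : Cl).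

(** Only limits from the right occur: the lower half-space is reached with height s t, s = -1. *)
Definition cvg_cl (f : R -> Cl) (l : Cl) :=
  forall A, cl_coord (f t) A @[t --> 0^'+] --> cl_coord l A.

Lemma cvgr_sum (I : Type) (r : seq I) (f : I -> R -> R) (l : I -> R) :
  (forall i, f i t @[t --> 0^'+] --> l i) ->
  \sum_(i <- r) f i t @[t --> 0^'+] --> \sum_(i <- r) l i.
Proof.
move=> fl; elim: r => [|i r IH].
  by rewrite big_nil; under eq_fun do rewrite big_nil; exact: cvg_cst.
by rewrite big_cons; under eq_fun do rewrite big_cons; exact: cvgD.
Qed.

Lemma coord_mul a c A : cl_coord (a * c) A =
  \sum_B (blade_sign R B (symdiff B A) * cl_coord a B) * cl_coord c (symdiff B A).
Proof. by rewrite /cl_coord ffunE. Qed.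

Lemma cvg_cl_mull a f l : cvg_cl f l -> cvg_cl (fun t => a * f t) (a * l).
Proof.
move=> fl A; rewrite coord_mul; under eq_fun do rewrite coord_mul.
by apply: cvgr_sum => B; apply: cvgM; [exact: cvg_cst|exact: fl].
Qed.

Lemma cvg_cl_sum (I : finType) (f : I -> R -> Cl) (l : I -> Cl) :
  (forall i, cvg_cl (f i) (l i)) -> cvg_cl (fun t => \sum_i f i t) (\sum_i l i).
Proof.
move=> fl A; rewrite /cl_coord sum_ffunE.
rewrite (_ : (fun t => _) = fun t => \sum_i cl_coord (f i t) A).
  by apply: cvgr_sum => i; exact: fl.
by apply/funext => t; rewrite sum_ffunE.
Qed.

Lemma cvg_clD (f g : R -> Cl) (k l : Cl) :
  cvg_cl f k -> cvg_cl g l -> cvg_cl (fun t => f t + g t) (k + l).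
Proof.
move=> fk gl A; rewrite /cl_coord ffunE; under eq_fun do rewrite ffunE.
by apply: cvgD; [exact: fk|exact: gl].
Qed.

Lemma cvg_clZ (f : R -> R) (l : R) c : f t @[t --> 0^'+] --> l ->
  cvg_cl (fun t => f t *: c) (l *: c).
Proof.
move=> fl A; rewrite /cl_coord ffunE; under eq_fun do rewrite ffunE.
by apply: cvgM => //; exact: cvg_cst.
Qed.

Lemma cvg_cl_near (f g : R -> Cl) l : (forall t, 0 < t -> f t = g t) ->
  cvg_cl f l -> cvg_cl g l.
Proof.
move=> fg fl A; apply: cvg_trans (fl A); apply: near_eq_cvg; near=> t.
by rewrite fg//; near: t; exact: nbhs_right_gt.
Unshelve. all: by end_near. Qed.

Lemma test_bounds phi : test_function phi -> exists B rho : R,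
  [/\ forall y, `|phi y| <= B, forall i y, `|partial i phi y| <= B, 0 < rho &
      forall y, phi y != 0 -> enorm y <= rho].
Proof.
move=> [sp [K cK sK]]; have [M M0 pM] := supported_bounded cK sK (smooth_continuous sp).
have [rho rho0 Hrho] := supported_radius cK.
have /choice[B HB] : forall i, exists B : R, 0 < B /\ forall y, `|partial i phi y| <= B.
  move=> i; have [B B0 H] := supported_bounded cK (supported_partial cK sK)
    (smooth_continuous (smooth_partial i sp)).
  by exists B.
have S0 : 0 <= \sum_i B i by apply: sumr_ge0 => i _; rewrite ltW//; have [] := HB i.
exists (M + \sum_i B i), rho; split=> //.
- by move=> y; rewrite (le_trans (pM y))// lerDl.
- move=> i y; have [_ /(_ y) H] := HB i; rewrite (le_trans H)// (bigD1 i)//=.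
  rewrite addrCA lerDl; apply: addr_ge0; first exact: ltW.
  by apply: sumr_ge0 => k _; rewrite ltW//; have [] := HB k.
- exact: Hrho.
Qed.

Definition pv_integral (j : 'I_m) phi : R := integral_rV (pv_density j phi).

Lemma continuous_coordM (j : 'I_m) phi : test_function phi ->
  integrable_rV (fun y => y 0 j * phi y).
Proof. by move=> tp; apply: integrable_test => //; exact: coord_continuous. Qed.

Lemma pv_integral_cvg (j : 'I_m) (k : R -> 'rV[R]_m -> R) phi : test_function phi ->
  (forall t, 0 < t <= 1 -> measurable_rV (k t)) ->
  (forall t y, k t (- y) = k t y) ->
  (forall t y, 0 < t <= 1 -> 0 < enorm y -> 0 <= k t y <= (enorm y)^-1 ^+ m.+1) ->
  (forall y, 0 < enorm y -> k t y @[t --> 0^'+] --> (enorm y)^-1 ^+ m.+1) ->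
  (forall t, 0 < t <= 1 -> integrable_rV (fun y => y 0 j * k t y * phi y)) ->
  integrable_rV (pv_density j phi) /\
  integral_rV (fun y => y 0 j * k t y * phi y) @[t --> 0^'+] --> pv_integral j phi.
Proof.
move=> tp mk ke kl kc ki; have [B [rho [_ pB rho0 pr]]] := test_bounds tp.
by apply: (odd_kernel_cvg mk ke kl kc ki _ pB rho0 pr); have [] := tp.
Qed.

Definition cutoff t y : R := if t < enorm y then (enorm y)^-1 ^+ m.+1 else 0.

Lemma enormN y : enorm (- y) = enorm y.
Proof. by rewrite /enorm; congr Num.sqrt; apply: eq_bigr => i _; rewrite mxE sqrrN. Qed.

Lemma measurable_cutoff t : measurable_rV (cutoff t).
Proof.
apply: measurable_rV_if; last exact: measurable_rV_cst.
  by apply: measurable_fun_ltr => //; exact: measurable_enorm.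
by apply: measurable_rVX; exact: measurable_enorm_inv.
Qed.

Lemma integrable_cutoff t (j : 'I_m) phi : 0 < t -> test_function phi ->
  integrable_rV (fun y => y 0 j * cutoff t y * phi y).
Proof.
move=> t0 tp; have ip := continuous_coordM j tp.
have ipn : integrable_rV (fun y => `|y 0 j * phi y|) by exact: (integrable_norm ip).
have mphi : measurable_rV phi.
  by apply: continuous_measurable_rV; apply: smooth_continuous; have [] := tp.
apply: (integrable_rV_le _ (integrable_rVZ (t^-1 ^+ m.+1) ipn)).
  apply: measurable_rVM => //; apply: measurable_rVM; first exact: measurable_rV_coord.
  exact: measurable_cutoff.
move=> y; rewrite mulrAC normrM mulrC ler_wpM2r// /cutoff.
case: ifPn => [ty|_]; last by rewrite normr0 exprn_ge0// invr_ge0 ltW.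
have e0 := lt_trans t0 ty.
rewrite ger0_norm ?exprn_ge0 ?invr_ge0 ?enorm_ge0// lerXn2r ?nnegrE ?invr_ge0 ?enorm_ge0 ?(ltW t0)//.
by rewrite lef_pV2 ?posrE// ltW.
Qed.

Lemma cutoff_cvg (j : 'I_m) phi : test_function phi ->
  integrable_rV (pv_density j phi) /\
  integral_rV (fun y => y 0 j * cutoff t y * phi y) @[t --> 0^'+] --> pv_integral j phi.
Proof.
move=> tp; apply: pv_integral_cvg => //.
- by move=> t _; exact: measurable_cutoff.
- by move=> t y; rewrite /cutoff enormN.
- move=> t y _ y0; rewrite /cutoff; case: ifP => _; rewrite ?lexx ?andbT ?andTb//.
    by rewrite exprn_ge0// invr_ge0 ltW.
  by rewrite exprn_ge0// invr_ge0 ltW.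
- move=> y y0; apply: cvg_near_cst; near=> t; rewrite /cutoff ifT//.
- by move=> t /andP[t0 _]; exact: integrable_cutoff.
Unshelve. all: by end_near. Qed.

Lemma integrable_radial_coord t (j : 'I_m) phi : 0 < t -> test_function phi ->
  integrable_rV (fun y => y 0 j * radial_inv t y ^+ m.+1 * phi y).
Proof.
move=> t0 tp; have [B [rho [pB _ rho0 pr]]] := test_bounds tp.
have mphi : measurable_rV phi.
  by apply: continuous_measurable_rV; apply: smooth_continuous; have [] := tp.
have mf : measurable_rV (fun y => y 0 j * phi y).
  by apply: measurable_rVM => //; exact: measurable_rV_coord.
have fB y : `|y 0 j * phi y| <= rho * B.
  have [->|py] := eqVneq (phi y) 0.
    rewrite mulr0 normr0; apply: mulr_ge0; first exact: ltW.
    exact: le_trans (normr_ge0 _) (pB y).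
  by rewrite normrM ler_pM// (le_trans (coord_le_enorm y j))// pr.
have := integrable_rVZ t^-1 (integrable_radialM t0 mf fB).
congr integrable_rV; apply/funext => y; rewrite -!mulrA mulKf ?lt0r_neq0//; ring.
Qed.

Lemma radial_inv_cvg y : 0 < enorm y -> radial_inv t y @[t --> 0^'+] --> (enorm y)^-1.
Proof.
move=> y0; apply: cvgV; first by rewrite gt_eqF.
apply: (continuous_cvg _ (@sqrt_continuous R _)).
rewrite -[X in _ --> X]add0r; apply: cvgD; last exact: cvg_cst.
rewrite -[X in _ --> X](expr0n R 2) ; apply: cvg_at_right_filter.
exact: exprn_continuous.
Qed.

(** The second regularisation: smoothing by the height t has the same limit as the truncations,
    which identifies the vector part of the boundary value with a principal value. *)
Lemma radial_coord_cvg (j : 'I_m) phi : test_function phi ->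
  integral_rV (fun y => y 0 j * radial_inv t y ^+ m.+1 * phi y) @[t --> 0^'+] -->
  pv_integral j phi.
Proof.
move=> tp; have [] // := @pv_integral_cvg j (fun t y => radial_inv t y ^+ m.+1) phi tp.
- by move=> t _; apply: measurable_rVX; exact: measurable_radial_inv.
- move=> t y; rewrite /radial_inv; do 4 f_equal.
  by apply: eq_bigr => i _; rewrite mxE sqrrN.
- move=> t y /andP[t0 _] y0; rewrite exprn_ge0 ?radial_inv_ge0//=.
  by rewrite lerXn2r ?nnegrE ?radial_inv_ge0 ?invr_ge0 ?enorm_ge0// radial_inv_le.
- by move=> y y0; apply: (continuous_cvg _ (@exprn_continuous R _ _)); exact: radial_inv_cvg.
- by move=> t /andP[t0 _]; exact: integrable_radial_coord.
Qed.

(** The [lim] in [pv] has its intended value only once convergence is proved; [cutoff_cvg] supplies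
    this componentwise. *)
Lemma hilbertE phi : test_function phi ->
  hilbert phi = \sum_j pv_integral j phi *: (- (2 / sigma) *: e_ R j).
Proof.
move=> tp; rewrite /hilbert.
have -> : pv (fun y => (enorm y ^+ m)^-1 *: ((enorm y)^-1 *: vec y)) phi =
    \sum_j pv_integral j phi *: e_ R j.
  apply: clP => A; rewrite coord_sum {1}/cl_coord ffunE.
  apply: (cvg_lim (@Rhausdorff R)).
  have : \sum_j integral_rV (fun y => y 0 j * cutoff t y * phi y) * cl_coord (e_ R j) A
     @[t --> 0^'+] --> \sum_j pv_integral j phi * cl_coord (e_ R j) A.
    by apply: cvgr_sum => j; apply: cvgM; [have [] := cutoff_cvg j tp|exact: cvg_cst].
  apply: cvg_trans; apply: near_eq_cvg; near=> t.
  have t0 : 0 < t by near: t; exact: nbhs_right_gt.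
  rewrite (regular_sum (f := fun j y => y 0 j * cutoff t y) (c := @e_ R m)).
  - by rewrite coord_sum.
  - move=> y; rewrite /cutoff; case: ifP => _.
      rewrite scalerA /vec scaler_sumr; apply: eq_bigr => j _; rewrite scalerA.
      by congr (_ *: _); rewrite -!exprVn exprS; ring.
    by rewrite big1// => j _; rewrite mulr0 scale0r.
  - by move=> j; exact: integrable_cutoff.
rewrite scaler_sumr; apply: eq_bigr => j _.
by rewrite !scalerA mulrC.
Unshelve. all: by end_near. Qed.

Definition boundary_value (s : R) : functional R m :=
  addd (lmuld (s / 2)%:A (@delta R m)) (lmuld (2^-1)%:A (lmuld e0b (@hilbert R m))).

Lemma boundary_value_cvg (s : R) phi : s ^+ 2 = 1 -> test_function phi ->
  cvg_cl (fun t => regular (fun y => Cneg 1 (Defs.point (s * t) y)) phi)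
    (boundary_value s phi).
Proof.
move=> s1 tp; have s0 : s != 0.
  by apply/eqP => s0; move: s1; rewrite s0 expr0n => /eqP; rewrite eq_sym oner_eq0.
have [B [rho [pB _ rho0 pr]]] := test_bounds tp.
have cphi : continuous phi by apply: smooth_continuous; have [] := tp.
have sg0 := @sphere_area_gt0 R m.
(* The normalisation 1/sigma meets the mass sigma/2, giving delta/2; likewise half of -2/sigma
   matches the coefficient of - e0bar e_j in the kernel. *)
have E : boundary_value s phi =
    (s * (sigma / 2 * phi 0)) *: (para_conj ord0 * sigma^-1%:A) +
    \sum_j pv_integral j phi *: (para_conj (lift ord0 j) * sigma^-1%:A).
  rewrite /boundary_value /addd /lmuld hilbertE// /delta; congr (_ + _).
    rewrite para_conj0 mul1r -scalerAl mul1r !scalerA; congr (_ *: _).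
    by field; rewrite gt_eqF.
  rewrite -scalerAl mul1r !mulr_sumr scaler_sumr; apply: eq_bigr => j _.
  rewrite para_conj_lift -!scalerAr mulr1 !scalerA scalerN -scaleNr; congr (_ *: _).
  by field; rewrite gt_eqF.
rewrite E; apply: (cvg_cl_near (f := fun t =>
  (s * integral_rV (fun y => t * radial_inv t y ^+ m.+1 * phi y)) *: (para_conj ord0 * sigma^-1%:A) +
  \sum_j integral_rV (fun y => y 0 j * radial_inv t y ^+ m.+1 * phi y) *:
     (para_conj (lift ord0 j) * sigma^-1%:A))).
  move=> t t0; have st : s * t != 0 by rewrite mulf_neq0// lt0r_neq0.
  (* As s^2 = 1, the norm does not see the sign; only the normal coordinate s t does. *)
  have N y : (enorm (Defs.point (s * t) y))^-1 = radial_inv t y.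
    by rewrite enorm_point_inv /radial_inv exprMn s1 mul1r.
  rewrite regular_Cneg// big_ord_recl; congr (_ *: _ + _).
    rewrite -integral_rVZ; last first.
      by apply: (integrable_radialM t0 _ pB); exact: continuous_measurable_rV.
    congr integral_rV; apply/funext => y.
    by rewrite /= keval_pow /= N point_ord0 exprS; ring.
  apply: eq_bigr => j _; congr (_ *: _); congr integral_rV; apply/funext => y.
  by rewrite /= keval_pow /= N point_lift exprS; ring.
apply: cvg_clD.
  apply: cvg_clZ; apply: cvgM; first exact: cvg_cst.
  apply: poisson_approx pB _; first exact: continuous_measurable_rV.
  exact: cphi.
apply: cvg_cl_sum => j; apply: cvg_clZ; exact: radial_coord_cvg.
Qed.
End BoundaryValues.

(** * Distributions and boundary values of all potentials *)

Section Distributions.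
Context {R : realType} {m : nat}.
Local Notation Cl := (clifford R m.+1).
Local Notation e0b := (e0bar R m).
Local Notation sigma := (sphere_area R m.+1).
Implicit Types (phi psi : 'rV[R]_m -> R) (a c : Cl) (S T : functional R m).

Lemma partial_lin j (k : R) phi psi : smooth phi -> smooth psi ->
  partial j (fun y => k * phi y + psi y) = fun y => k * partial j phi y + partial j psi y.
Proof.
move=> sp ss; apply/funext => y.
have dp : derivable phi y (delta_mx 0 j).
  by apply: diff_derivable; exact: smooth_differentiable.
have ds : derivable psi y (delta_mx 0 j).
  by apply: diff_derivable; exact: smooth_differentiable.
rewrite /partial (_ : (fun y => _) = k \*: phi + psi)//.
by rewrite deriveD ?deriveZ//; exact: derivableZ.
Qed.

Lemma partials_lin s (k : R) phi psi : smooth phi -> smooth psi ->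
  partials s (fun y => k * phi y + psi y) = fun y => k * partials s phi y + partials s psi y.
Proof.
move=> sp ss; elim: s => //= i s IH; rewrite -/(partials s _) IH partial_lin//.
  by move=> r x; have := sp (r ++ s) x; rewrite /partials foldr_cat.
by move=> r x; have := ss (r ++ s) x; rewrite /partials foldr_cat.
Qed.

Lemma smooth_lin (k : R) phi psi : smooth phi -> smooth psi ->
  smooth (fun y => k * phi y + psi y).
Proof.
move=> sp ss s x; rewrite partials_lin//.
rewrite (_ : (fun y => _) = k \*: partials s phi + partials s psi)//.
by apply: differentiableD; [apply: differentiableZ; exact: sp|exact: ss].
Qed.

Lemma test_function_lin (k : R) phi psi : test_function phi -> test_function psi ->
  test_function (fun y => k * phi y + psi y).
Proof.
move=> [sp [K cK sK]] [ss [K' cK' sK']]; split; first exact: smooth_lin.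
exists (K `|` K'); first exact: compactU.
rewrite /supported_in; apply: subset_trans (setUSS sK sK'); rewrite -closureU.
apply: closure_subset => y /=; have [->|p0 _] := eqVneq (phi y) 0; last by left.
by rewrite mulr0 add0r; right.
Qed.

Lemma is_distributionD S T : is_distribution S -> is_distribution T -> is_distribution (addd S T).
Proof.
move=> [Sl Sb] [Tl Tb]; split=> [k phi psi tp ts|K cK].
  by rewrite /addd Sl// Tl// scalerDr addrACA.
have [c1 [N1 H1]] := Sb K cK; have [c2 [N2 H2]] := Tb K cK.
exists (c1 + c2), (maxn N1 N2) => phi B tp sK pB A.
rewrite /addd /cl_coord ffunE mulrDl (le_trans (ler_normD _ _))// lerD//.
  by apply: H1 => // s y sN; apply: pB; rewrite leq_max sN.
by apply: H2 => // s y sN; apply: pB; rewrite leq_max sN orbT.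
Qed.

Lemma is_distribution_lmul a T : is_distribution T -> is_distribution (lmuld a T).
Proof.
move=> [Tl Tb]; split=> [k phi psi tp ts|K cK].
  by rewrite /lmuld Tl// mulrDr scalerAr.
have [c [N H]] := Tb K cK.
exists (\sum_B `|cl_coord a B| * c), N => phi B tp sK pB A.
rewrite /lmuld coord_mul mulr_suml (le_trans (ler_norm_sum _ _ _))//.
apply: ler_sum => C _; rewrite !normrM -[leRHS]mulrA ler_pM ?mulr_ge0//.
  (* Blade signs square to 1, so they do not affect the estimate. *)
  have s1 : `|blade_sign R C (symdiff C A)| = 1.
    apply: (@pexpIrn _ 2) => //; rewrite ?nnegrE// expr1n expr2 -normrM.
    by rewrite blade_sign_sq normr1.
  by rewrite s1 mul1r.
by apply: H => // s y sN; exact: pB.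
Qed.

Lemma is_distribution_partial j T : is_distribution T ->
  is_distribution (fun phi => T (partial j phi)).
Proof.
move=> [Tl Tb]; split=> [k phi psi tp ts|K cK].
  rewrite partial_lin; [|by case: tp|by case: ts].
  by apply: Tl; exact: test_function_partial.
have [c [N H]] := Tb K cK; exists c, N.+1 => phi B tp sK pB A.
apply: H; [exact: test_function_partial|exact: supported_partial|].
move=> s y sN; have := pB (rcons s j) y; rewrite size_rcons ltnS => /(_ sN).
by rewrite /partials foldr_rcons.
Qed.

Lemma is_distribution_zero : is_distribution (fun=> 0 : Cl).
Proof.
split=> [k phi psi _ _|K _]; first by rewrite scaler0 addr0.
by exists 0, 0%N => phi B _ _ _ A; rewrite /cl_coord ffunE normr0 mul0r.
Qed.

Lemma is_distribution_sum (I : Type) (r : seq I) (T : I -> functional R m) :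
  (forall i, is_distribution (T i)) -> is_distribution (fun phi => \sum_(i <- r) T i phi).
Proof.
move=> dT; elim: r => [|i r IH].
  by under eq_fun do rewrite big_nil; exact: is_distribution_zero.
by under eq_fun do rewrite big_cons; exact: is_distributionD.
Qed.

Lemma is_distribution_opp T : is_distribution T -> is_distribution (oppd T).
Proof.
move=> dT; have := is_distribution_lmul (-1) dT.
by congr is_distribution; apply/funext => phi; rewrite /lmuld mulN1r.
Qed.

Lemma is_distribution_dirac T : is_distribution T -> is_distribution (diracd T).
Proof.
move=> dT; apply: is_distribution_opp.
by apply: is_distribution_sum => j; apply: is_distribution_lmul; exact: is_distribution_partial.
Qed.

(** Needed for [hilbert], whose closed formula is available on test functions only. *)
Lemma is_distribution_ext S T : eq_dist S T -> is_distribution T -> is_distribution S.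
Proof.
move=> ST [Tl Tb]; split=> [k phi psi tp ts|K cK].
  by rewrite !ST// ?Tl//; exact: test_function_lin.
have [c [N H]] := Tb K cK; exists c, N => phi B tp sK pB A.
by rewrite ST//; exact: H.
Qed.

Lemma is_distribution_scalar (q : ('rV[R]_m -> R) -> R) c :
  (forall (k : R) phi psi, test_function phi -> test_function psi ->
     q (fun y => k * phi y + psi y) = k * q phi + q psi) ->
  (forall K : set 'rV[R]_m, compact K -> exists (C : R) (N : nat), forall phi (B : R),
     test_function phi -> supported_in K phi ->
     (forall s y, (size s <= N)%N -> `|partials s phi y| <= B) -> `|q phi| <= C * B) ->
  is_distribution (fun phi => q phi *: c).
Proof.
move=> ql qb; split=> [k phi psi tp ts|K cK].
  by rewrite ql// scalerDl scalerA.
have [C [N H]] := qb K cK.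
exists (C * \sum_A `|cl_coord c A|), N => phi B tp sK pB A.
have -> : cl_coord (q phi *: c) A = q phi * cl_coord c A by rewrite /cl_coord ffunE.
rewrite normrM mulrAC ler_pM//; first exact: H.
rewrite (bigD1 A)//= lerDl.
by apply: sumr_ge0.
Qed.

Lemma is_distribution_delta : is_distribution (@delta R m).
Proof.
apply: (is_distribution_scalar (q := fun phi => phi 0)) => // K cK.
by exists 1, 0%N => phi B _ _ pB; rewrite mul1r; exact: (pB [::]).
Qed.

Lemma pv_integral_lin j (k : R) phi psi : test_function phi -> test_function psi ->
  pv_integral j (fun y => k * phi y + psi y) = k * pv_integral j phi + pv_integral j psi.
Proof.
move=> tp ts; have [ip _] := cutoff_cvg j tp; have [iq _] := cutoff_cvg j ts.
rewrite /pv_integral -integral_rVZ// -integral_rVD//; last exact: integrable_rVZ.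
congr integral_rV; apply/funext => y; rewrite /pv_density; ring.
Qed.

Lemma is_distribution_pv j c : is_distribution (fun phi => pv_integral j phi *: c).
Proof.
apply: is_distribution_scalar => [|K cK]; first exact: pv_integral_lin.
have [rho rho0 Hrho] := supported_radius cK.
(* The ball of radius rho contains all supports in [K], so the constant depends on [K] alone; the
   order is 1 because the odd part is controlled by first derivatives. *)
exists (m%:R * integral_rV (@riesz R m rho)), 1%N => phi B tp sK pB.
have [ip _] := cutoff_cvg j tp.
have pi := integrable_rVZ (m%:R * B) (integrable_riesz m rho0).
rewrite mulrAC -integral_rVZ; last exact: integrable_riesz.
apply: le_norm_integral_rV => // y; apply: pv_density_le.
- by case: tp.
- by move=> i x; exact: (pB [:: i]).
- exact: Hrho.
Qed.

Lemma is_distribution_hilbert : is_distribution (@hilbert R m).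
Proof.
apply: is_distribution_ext (fun phi tp => hilbertE tp) _.
by apply: is_distribution_sum => j; exact: is_distribution_pv.
Qed.

(* Since [D C = 0], [Dbar] acts on the potentials as the tangential operator [- e0bar dirac]. *)
Definition dirac_step T : functional R m := lmuld (- e0b) (diracd T).

Definition boundary_values (s : R) k : functional R m := iter k dirac_step (boundary_value s).

Lemma is_distribution_boundary s k : is_distribution (boundary_values s k).
Proof.
elim: k => [|k IH] /=; last by apply: is_distribution_lmul; exact: is_distribution_dirac.
apply: is_distributionD; apply: is_distribution_lmul; first exact: is_distribution_delta.
by apply: is_distribution_lmul; exact: is_distribution_hilbert.
Qed.

Lemma dirac_stepE T phi : dirac_step T phi = \sum_j e0b * e_ R j * T (partial j phi).
Proof.
rewrite /dirac_step /lmuld /diracd mulrNN mulr_sumr.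
by apply: eq_bigr => j _; rewrite mulrA.
Qed.

(** Induction on k for all test functions at once, since each step replaces phi by its partial
    derivatives. *)
Lemma boundary_values_cvg s k phi : s ^+ 2 = 1 -> test_function phi ->
  cvg_cl (fun t => regular (fun y => Cneg k.+1 (Defs.point (s * t) y)) phi)
    (boundary_values s k phi).
Proof.
move=> s1; have s0 : s != 0.
  by apply/eqP => s0; move: s1; rewrite s0 expr0n => /eqP; rewrite eq_sym oner_eq0.
elim: k phi => [|k IH] phi tp; first exact: boundary_value_cvg.
rewrite (_ : boundary_values s k.+1 phi = \sum_j e0b * e_ R j * boundary_values s k (partial j phi)); last exact: dirac_stepE.
apply: (@cvg_cl_near _ _ (fun t => \sum_j e0b * e_ R j *
   regular (fun y => Cneg k.+1 (Defs.point (s * t) y)) (partial j phi))).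
  by move=> t t0; rewrite regular_Cneg_next// mulf_neq0// lt0r_neq0.
by apply: cvg_cl_sum => j; apply: cvg_cl_mull; apply: IH; exact: test_function_partial.
Qed.

Lemma boundary_values_lmul_cvg s k a phi : s ^+ 2 = 1 -> test_function phi ->
  cvg_cl (fun t => regular (fun y => a * Cneg k.+1 (Defs.point (s * t) y)) phi)
    (lmuld a (boundary_values s k) phi).
Proof.
move=> s1 tp; have s0 : s != 0.
  by apply/eqP => s0; move: s1; rewrite s0 expr0n => /eqP; rewrite eq_sym oner_eq0.
apply: (@cvg_cl_near _ _ (fun t => a * regular (fun y => Cneg k.+1 (Defs.point (s * t) y)) phi)).
  by move=> t t0; rewrite regular_Cneg_lmul// mulf_neq0// lt0r_neq0.
by apply: cvg_cl_mull; exact: boundary_values_cvg.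
Qed.

Lemma lim_above_Cneg k a : lim_above (fun x => a * Cneg k.+1 x) (lmuld a (boundary_values 1 k)).
Proof.
split=> [|phi A tp]; first by apply: is_distribution_lmul; exact: is_distribution_boundary.
have := @boundary_values_lmul_cvg 1 k a phi (expr1n R 2) tp A.
by under eq_fun do rewrite mul1r.
Qed.

Lemma lim_below_Cneg k a : lim_below (fun x => a * Cneg k.+1 x) (lmuld a (boundary_values (-1) k)).
Proof.
split=> [|phi A tp]; first by apply: is_distribution_lmul; exact: is_distribution_boundary.
have s1 : (-1) ^+ 2 = 1 :> R by rewrite sqrrN expr1n.
have := @boundary_values_lmul_cvg (-1) k a phi s1 tp A.
under eq_fun do rewrite mulN1r.
(* The limit from the right in -t is the limit from the left in t. *)
by move=> H; apply/cvg_at_leftNP; rewrite oppr0.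
Qed.

Lemma lmuld1 T : lmuld 1 T = T.
Proof. by apply/funext => phi; rewrite /lmuld mul1r. Qed.

Lemma lmuldA a c T : lmuld a (lmuld c T) = lmuld (a * c) T.
Proof. by apply/funext => phi; rewrite /lmuld mulrA. Qed.

Lemma dirac_stepD S T : dirac_step (addd S T) = addd (dirac_step S) (dirac_step T).
Proof.
apply/funext => phi; rewrite /addd !dirac_stepE -big_split.
by apply: eq_bigr => j _; rewrite mulrDr.
Qed.

Lemma dirac_stepZ (r : R) T : dirac_step (lmuld r%:A T) = lmuld r%:A (dirac_step T).
Proof.
apply/funext => phi; rewrite /lmuld !dirac_stepE mulr_sumr.
by apply: eq_bigr => j _; rewrite -!scalerAl !mul1r scalerAr.
Qed.

Lemma iter_dirac_stepD k S T :
  iter k dirac_step (addd S T) = addd (iter k dirac_step S) (iter k dirac_step T).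
Proof. by elim: k => //= k ->; exact: dirac_stepD. Qed.

Lemma iter_dirac_stepZ k (r : R) T :
  iter k dirac_step (lmuld r%:A T) = lmuld r%:A (iter k dirac_step T).
Proof. by elim: k => //= k ->; exact: dirac_stepZ. Qed.

Lemma diracd_e0bar T : diracd (lmuld e0b T) = oppd (lmuld e0b (diracd T)).
Proof.
apply/funext => phi; rewrite /diracd /oppd /lmuld mulrN opprK mulr_sumr -sumrN.
by apply: eq_bigr => j _; rewrite !mulrA e0bar_anticomm mulNr.
Qed.

Lemma diracdN T : diracd (oppd T) = oppd (diracd T).
Proof.
apply/funext => phi; rewrite /diracd /oppd; congr (- _); rewrite -sumrN.
by apply: eq_bigr => j _; rewrite mulrN.
Qed.

Lemma lmuldN a T : lmuld (- a) T = oppd (lmuld a T).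
Proof. by apply/funext => phi; rewrite /lmuld /oppd mulNr. Qed.

Lemma oppdK T : oppd (oppd T) = T.
Proof. by apply/funext => phi; rewrite /oppd opprK. Qed.

Lemma dirac_step2 T : dirac_step (dirac_step T) = diracd (diracd T).
Proof.
rewrite /dirac_step !(lmuldN e0b) diracdN diracd_e0bar oppdK lmuldA e0bar_sqr.
by rewrite lmuldN lmuld1 oppdK.
Qed.

Lemma diracd2_e0bar T : diracd (diracd (lmuld e0b T)) = lmuld e0b (diracd (diracd T)).
Proof. by rewrite diracd_e0bar diracdN diracd_e0bar oppdK. Qed.

Lemma iter_dirac_step_even p T : iter p.*2 dirac_step T = iter p.*2 (@diracd R m) T.
Proof. by elim: p => //= p IH; rewrite ?doubleS /= dirac_step2 IH. Qed.

Lemma iter_diracd_e0bar p T :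
  iter p.*2 (@diracd R m) (lmuld e0b T) = lmuld e0b (iter p.*2 (@diracd R m) T).
Proof. by elim: p => //= p IH; rewrite ?doubleS /= IH diracd2_e0bar. Qed.

Lemma boundary_valuesE s k : boundary_values s k =
  addd (lmuld (s / 2)%:A (iter k dirac_step (@delta R m)))
       (lmuld (2^-1)%:A (iter k dirac_step (lmuld e0b (@hilbert R m)))).
Proof. by rewrite /boundary_values iter_dirac_stepD !iter_dirac_stepZ. Qed.

(** The delta term is odd in the sign s and the Hilbert term even, so the latter cancels here and
    the former in [boundary_sum]. *)
Lemma boundary_jump k : addd (boundary_values 1 k) (oppd (boundary_values (-1) k)) =
  iter k dirac_step (@delta R m).
Proof.
rewrite !boundary_valuesE; apply/funext => phi; rewrite /addd /oppd /lmuld.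
rewrite opprD addrACA subrr addr0 -mulrBl -scalerBl mulN1r mul1r opprK.
by rewrite (_ : 2^-1 + 2^-1 = 1) ?scale1r ?mul1r//; field.
Qed.

Lemma boundary_sum k : addd (boundary_values 1 k) (boundary_values (-1) k) =
  iter k dirac_step (lmuld e0b (@hilbert R m)).
Proof.
rewrite !boundary_valuesE; apply/funext => phi; rewrite /addd /lmuld.
rewrite addrACA -!mulrDl -!scalerDl -?mulrDl subrr !(mul0r, scale0r) add0r.
by rewrite (_ : 2^-1 + 2^-1 = 1) ?scale1r ?mul1r//; field.
Qed.

(** A real factor can be moved to the right of the generators; this covers the signs in the left
    monogenic couples. *)
Lemma left_monogenic_Cneg k (r : R) U : (forall x, U x -> x != 0) ->
  left_monogenic U (fun x => r *: Cneg k.+1 x : Cl).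
Proof.
move=> U0; apply: (@left_monogenic_component _ _ k (r / sigma)%:A) => // x x0.
rewrite CnegE// scaler_sumr; apply: eq_bigr => i _.
by rewrite -!scalerAr !scalerA; congr (_ *: _); ring.
Qed.

Lemma right_monogenic_Cneg k a U : (forall x, U x -> x != 0) ->
  right_monogenic U (fun x => a * Cneg k.+1 x).
Proof.
move=> U0; apply: (@right_monogenic_component _ _ k (sigma^-1 *: a)) => // x x0.
rewrite CnegE// mulr_sumr; apply: eq_bigr => i _.
by rewrite -!scalerAr mulr1 -scalerAl.
Qed.

End Distributions.

(* Jump relations and representations by monogenic couples *)
Local Close Scope classical_set_scope.

Theorem mainTheorem2 (R : realType) (m : nat) (m_gt0 : (0 < m)%N) :
  (forall n : nat, (0 < n)%N -> left_monogenic (@punctured R m) (Cneg n)) /\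
  exists cp cm : nat -> functional R m,
    (forall n : nat, (0 < n)%N ->
       lim_above (Cneg n) (cp n) /\ lim_below (Cneg n) (cm n)) /\
    forall l : nat, (0 < l)%N ->
    let dl (k : nat) : functional R m := iter k (@diracd R m) (@delta R m) in
    let dH (k : nat) : functional R m := iter k (@diracd R m) (@hilbert R m) in
    let Ceven : 'rV[R]_m.+1 -> clifford R m.+1 := Cneg (2 * l)%N in
    let Codd : 'rV[R]_m.+1 -> clifford R m.+1 := Cneg (2 * l + 1)%N in
    ((* index -2l *)
     [/\ eq_dist (addd (cp (2 * l)%N) (oppd (cm (2 * l)%N)))
                 (oppd (lmuld (e0bar R m) (dl (2 * l - 1)%N))),
         eq_dist (addd (cp (2 * l)%N) (cm (2 * l)%N))
                 (oppd (dH (2 * l - 1)%N)),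
         represents (@right_monogenic R m) (dl (2 * l - 1)%N)
                    (fun x => e0bar R m * Ceven x)
                    (fun x => e0bar R m * Ceven x) &
         represents (@left_monogenic R m) (dH (2 * l - 1)%N)
                    (fun x => - Ceven x)
                    (fun x => Ceven x)]) /\
    ((* index -2l-1 *)
     [/\ eq_dist (addd (cp (2 * l + 1)%N) (oppd (cm (2 * l + 1)%N)))
                 (dl (2 * l)%N),
         eq_dist (addd (cp (2 * l + 1)%N) (cm (2 * l + 1)%N))
                 (lmuld (e0bar R m) (dH (2 * l)%N)),
         represents (@left_monogenic R m) (dl (2 * l)%N)
                    (fun x => Codd x)
                    (fun x => Codd x) &
         represents (@right_monogenic R m) (dH (2 * l)%N)
                    (fun x => e0 R m * Codd x)
                    (fun x => e0bar R m * Codd x)]).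
Proof.
have U0 := @upper_half_neq0 R m; have L0 := @lower_half_neq0 R m.
have eta (F : 'rV[R]_m.+1 -> clifford R m.+1) : (fun x => 1 * F x) = F.
  by apply/funext => x; rewrite mul1r.
have etaN (F : 'rV[R]_m.+1 -> clifford R m.+1) : (fun x => - 1 * F x) = (fun x => - F x).
  by apply/funext => x; rewrite mulN1r.
have mono k U : (forall x, U x -> x != 0) -> left_monogenic U (@Cneg R m k.+1).
  move=> V0; have := left_monogenic_Cneg k 1 V0.
  by under eq_fun do rewrite scale1r.
have monoN k U : (forall x, U x -> x != 0) -> left_monogenic U (fun x => - @Cneg R m k.+1 x).
  move=> V0; have := left_monogenic_Cneg k (-1) V0.
  by under eq_fun do rewrite scaleN1r.
have above k : lim_above (@Cneg R m k.+1) (boundary_values 1 k).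
  by have := lim_above_Cneg k (1 : clifford R m.+1); rewrite eta lmuld1.
have below k : lim_below (@Cneg R m k.+1) (boundary_values (-1) k).
  by have := lim_below_Cneg k (1 : clifford R m.+1); rewrite eta lmuld1.
split; first by case=> // n _; apply: mono.
(* C_{-n} arises from C_{-1} by n-1 applications of [Dbar], hence the predecessor. *)
exists (fun n => boundary_values 1 n.-1), (fun n => boundary_values (-1) n.-1).
split; first by case=> // n _.
case=> // p _; cbv zeta.
(* With l = p+1 the order 2l-1 is the odd number 2p+1, and the order 2l is 2p+2. *)
have -> : (2 * p.+1 = (p.*2.+1).+1)%N by rewrite mul2n doubleS.
rewrite addn1 subn1 [_.-1]/=.
have evenJ : iter p.*2.+1 dirac_step (@delta R m) =
    oppd (lmuld (e0bar R m) (iter p.*2.+1 (@diracd R m) (@delta R m))).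
  by rewrite -lmuldN !iterS iter_dirac_step_even.
(* The remaining odd step acts on e0bar H: moving dirac past e0bar changes the sign, and - e0bar
   dirac e0bar = e0bar^2 dirac = - dirac. *)
have evenS : iter p.*2.+1 dirac_step (lmuld (e0bar R m) (@hilbert R m)) =
    oppd (iter p.*2.+1 (@diracd R m) (@hilbert R m)).
  rewrite !iterS iter_dirac_step_even iter_diracd_e0bar /dirac_step diracd_e0bar.
  by apply/funext => phi; rewrite /lmuld /oppd mulrNN mulrA e0bar_sqr mulN1r.
have oddJ : iter p.*2.+2 dirac_step (@delta R m) = iter p.*2.+2 (@diracd R m) (@delta R m).
  by rewrite -doubleS iter_dirac_step_even.
have oddS : iter p.*2.+2 dirac_step (lmuld (e0bar R m) (@hilbert R m)) =
    lmuld (e0bar R m) (iter p.*2.+2 (@diracd R m) (@hilbert R m)).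
  by rewrite -doubleS iter_dirac_step_even iter_diracd_e0bar.
have jump k phi : boundary_values 1 k phi - boundary_values (-1) k phi =
    iter k dirac_step (@delta R m) phi by rewrite -boundary_jump.
have sum k phi : boundary_values 1 k phi + boundary_values (-1) k phi =
    iter k dirac_step (lmuld (e0bar R m) (@hilbert R m)) phi by rewrite -boundary_sum.
split; split.
- by rewrite boundary_jump evenJ.
- by rewrite boundary_sum evenS.
- split; [exact: right_monogenic_Cneg|exact: right_monogenic_Cneg|].
  (* Multiplying the jump - e0bar dirac^(2l-1) delta by e0bar removes the factor, as e0bar^2 =
     -1. *)
  exists (lmuld (e0bar R m) (boundary_values 1 p.*2.+1)),
    (lmuld (e0bar R m) (boundary_values (-1) p.*2.+1)).
  split; [exact: lim_above_Cneg|exact: lim_below_Cneg|].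
  move=> phi _; rewrite /addd {1}/oppd {1 2}/lmuld -mulrBr jump evenJ /oppd /lmuld.
  by rewrite mulrN mulrA e0bar_sqr mulN1r opprK.
- split; [exact: monoN|exact: mono|].
  (* The sign in the upper function turns the difference of boundary values into minus their sum. *)
  exists (lmuld (-1) (boundary_values 1 p.*2.+1)), (boundary_values (-1) p.*2.+1).
  split; [|exact: below|].
    by have := lim_above_Cneg p.*2.+1 (-1 : clifford R m.+1); rewrite etaN.
  move=> phi _; rewrite /addd {1}/oppd {1}/lmuld mulN1r -opprD sum evenS.
  by rewrite /oppd opprK.
- by rewrite boundary_jump oddJ.
- by rewrite boundary_sum oddS.
- split; [exact: mono|exact: mono|].
  exists (boundary_values 1 p.*2.+2), (boundary_values (-1) p.*2.+2); split=> //.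
  by rewrite boundary_jump oddJ.
- split; [exact: right_monogenic_Cneg|exact: right_monogenic_Cneg|].
  (* Since e0bar = - e0, the difference becomes e0 times the sum, and e0 e0bar = 1 removes the
     factor in front of H. *)
  exists (lmuld (e0 R m) (boundary_values 1 p.*2.+2)),
    (lmuld (e0bar R m) (boundary_values (-1) p.*2.+2)).
  split; [exact: lim_above_Cneg|exact: lim_below_Cneg|].
  move=> phi _; rewrite /addd {1}/oppd {1 2}/lmuld mulNr opprK -mulrDr sum oddS.
  by rewrite /lmuld mulrA e0_e0bar mul1r.
Qed.
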